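(* The call-by-value catch/throw calculus has the Church–Rosser property: if $M_1$ and $M_2$ are equal in the congruence generated by its reduction rules, then there is a term $N$ with $M_1\to^*N$ and $M_2\to^*N$.
   Context: Call-by-value catch/throw calculus. Ordinary variables $x,y,z,\dots$ and continuation variables $k,l,\delta,\dots$ are disjoint. Terms: $M ::= x \mid \lambda x.M \mid MM \mid (M\ \mathsf{where}\ x:=M) \mid \varepsilon k.M \mid \mathsf{throw}_k M$, where $(L\ \mathsf{where}\ x:=M)$ means $\mathsf{let}\ x=M\ \mathsf{in}\ L$ ($x$ bound in $L$ only), $\varepsilon k$ binds $k$ (an exception block tagged $k$), and $\mathsf{throw}_k M$ raises $M$ to the block tagged $k$ ($k$ free). Terms are identified up to $\alpha$-conversion and the congruence generated by: $(L\ \mathsf{where}\ x:=(M\ \mathsf{where}\ y:=N))=((L\ \mathsf{where}\ x:=M)\ \mathsf{where}\ y:=N)$ if $y$ not free in $L$; $((\varepsilon k.M)\ \mathsf{where}\ x:=N)=\varepsilon k.(M\ \mathsf{where}\ x:=N)$ if $k$ not free in $N$; $((\mathsf{throw}_k M)\ \mathsf{where}\ x:=N)=\mathsf{throw}_k(M\ \mathsf{where}\ x:=N)$. Values $V$: variables and $\lambda$-abstractions; other terms are non-values ($N$ below). Reduction rules ($z$ fresh): $NM\to(zM\ \mathsf{where}\ z:=N)$; $VN\to(Vz\ \mathsf{where}\ z:=N)$; $(\lambda x.M)V\to(M\ \mathsf{where}\ x:=V)$; $(M\ \mathsf{where}\ x:=V)\to M\{V/x\}$; $\lambda x.Vx\to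 V$ ($x$ not free in $V$); $(x\ \mathsf{where}\ x:=M)\to M$; $\varepsilon\delta.M\to M$ ($\delta$ not free in $M$); $\varepsilon k.\mathsf{throw}_kM\to\varepsilon k.M$; $(M\ \mathsf{where}\ x:=\mathsf{throw}_kN)\to\mathsf{throw}_kN$; $\mathsf{throw}_l\mathsf{throw}_kN\to\mathsf{throw}_kN$; $(M\ \mathsf{where}\ x:=\varepsilon k.N)\to\varepsilon k.(M\ \mathsf{where}\ x:=N\{\mathsf{throw}_k\square\mapsto\mathsf{throw}_k(M\ \mathsf{where}\ x:=\square)\})$; $\mathsf{throw}_l\varepsilon k.M\to\mathsf{throw}_l(M\{l/k\})$; $\varepsilon l.\varepsilon k.M\to\varepsilon l.M\{l/k\}$. Here $\{\mathsf{throw}_k\square\mapsto\mathsf{throw}_k(M\ \mathsf{where}\ x:=\square)\}$ replaces recursively each subterm $\mathsf{throw}_kQ$ with $k$ free by $\mathsf{throw}_k(M\ \mathsf{where}\ x:=Q)$ (capture-avoiding), and $\{l/k\}$ replaces each such $\mathsf{throw}_kQ$ by $\mathsf{throw}_lQ$. $\to$ is the compatible closure, $\to^*$ its reflexive-transitive closure. *)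

(* Defs.v *)
(* Call-by-value catch/throw calculus, locally nameless-free
   representation: de Bruijn indices for BOTH sorts of variables, in two
   independent index spaces (ordinary variables, bound by [Lam] and by the
   body of [Where]; continuation variables, bound by [Eps]).  Alpha-conversion
   is thus built in. *)
From Stdlib Require Import Arith Relations.

(* Where L M  =  (L where x := M), x = index 0 bound in L only.
   Eps M      =  eps k. M, k = continuation index 0 in M.
   Throw k M  =  throw_k M, k a continuation index. *)
Inductive term : Type :=
| Var   : nat -> term
| Lam   : term -> term
| App   : term -> term -> term
| Where : term -> term -> term
| Eps   : term -> term
| Throw : nat -> term -> term.

Definition is_value (M : term) : Prop :=
  match M with Var _ | Lam _ => True | _ => False end.

Fixpoint lift (c : nat) (M : term) : term :=
  match M with
  | Var n => if c <=? n then Var (S n) else Var n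
  | Lam M => Lam (lift (S c) M)
  | App M N => App (lift c M) (lift c N)
  | Where L N => Where (lift (S c) L) (lift c N)
  | Eps M => Eps (lift c M)
  | Throw k M => Throw k (lift c M)
  end.

Fixpoint klift (c : nat) (M : term) : term :=
  match M with
  | Var n => Var n
  | Lam M => Lam (klift c M)
  | App M N => App (klift c M) (klift c N)
  | Where L N => Where (klift c L) (klift c N)
  | Eps M => Eps (klift (S c) M)
  | Throw k M => Throw (if c <=? k then S k else k) (klift c M)
  end.

(* capture-avoiding substitution M{V/x} for ordinary index c (V given
   relative to the current binder depth), removing the binder *)
Fixpoint subst (c : nat) (V : term) (M : term) : term :=
  match M with
  | Var n => if n =? c then V else if c <? n then Var (pred n) else Var n
  | Lam M => Lam (subst (S c) (lift 0 V) M)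
  | App M N => App (subst c V M) (subst c V N)
  | Where L N => Where (subst (S c) (lift 0 V) L) (subst c V N)
  | Eps M => Eps (subst c (klift 0 V) M)
  | Throw k M => Throw k (subst c V M)
  end.

(* M{l/k} where k is the continuation index d (d = number of Eps crossed)
   being removed, and l is an index of the context after removal *)
Fixpoint krename (d l : nat) (M : term) : term :=
  match M with
  | Var n => Var n
  | Lam M => Lam (krename d l M)
  | App M N => App (krename d l M) (krename d l N)
  | Where L N => Where (krename d l L) (krename d l N)
  | Eps M => Eps (krename (S d) l M)
  | Throw i Q =>
      Throw (if i <? d then i else if i =? d then l + d else pred i)
            (krename d l Q)
  end.

(* N{throw_k [] |-> throw_k (P where x := [])}: P lives under one ordinary
   binder x (index 0), k is a continuation index. Recursive in Q. *)
Fixpoint csubst (P : term) (k : nat) (N : term) : term :=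
  match N with
  | Var n => Var n
  | Lam M => Lam (csubst (lift 1 P) k M)
  | App M1 M2 => App (csubst P k M1) (csubst P k M2)
  | Where L M => Where (csubst (lift 1 P) k L) (csubst P k M)
  | Eps M => Eps (csubst (klift 0 P) (S k) M)
  | Throw j Q =>
      if j =? k then Throw j (Where P (csubst P k Q))
      else Throw j (csubst P k Q)
  end.

Inductive compat (R : relation term) : relation term :=
| c_base   : forall M N, R M N -> compat R M N
| c_lam    : forall M N, compat R M N -> compat R (Lam M) (Lam N)
| c_appl   : forall M N P, compat R M N -> compat R (App M P) (App N P)
| c_appr   : forall M N P, compat R M N -> compat R (App P M) (App P N)
| c_wherel : forall M N P, compat R M N -> compat R (Where M P) (Where N P)
| c_wherer : forall M N P, compat R M N -> compat R (Where P M) (Where P N)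
| c_eps    : forall M N, compat R M N -> compat R (Eps M) (Eps N)
| c_throw  : forall k M N, compat R M N -> compat R (Throw k M) (Throw k N).

(* the three structural equations (side conditions on freshness are built
   into the de Bruijn representation) *)
Inductive struct_eq : relation term :=
| se_assoc : forall L M N,
    struct_eq (Where L (Where M N)) (Where (Where (lift 1 L) M) N)
| se_eps : forall M N,
    struct_eq (Where (Eps M) N) (Eps (Where M (klift 0 N)))
| se_throw : forall k M N,
    struct_eq (Where (Throw k M) N) (Throw k (Where M N)).

Definition sequiv : relation term := clos_refl_sym_trans term (compat struct_eq).

Inductive rule : relation term :=
| r_appl : forall N M, ~ is_value N ->
    rule (App N M) (Where (App (Var 0) (lift 0 M)) N)
| r_appr : forall V N, is_value V -> ~ is_value N ->
    rule (App V N) (Where (App (lift 0 V) (Var 0)) N)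
| r_beta : forall M V, is_value V ->
    rule (App (Lam M) V) (Where M V)
| r_where_val : forall M V, is_value V ->
    rule (Where M V) (subst 0 V M)
| r_eta : forall V, is_value V ->
    rule (Lam (App (lift 0 V) (Var 0))) V
| r_where_var : forall M,
    rule (Where (Var 0) M) M
| r_eps_gc : forall M,
    rule (Eps (klift 0 M)) M
| r_eps_throw : forall M,
    rule (Eps (Throw 0 M)) (Eps M)
| r_where_throw : forall M k N,
    rule (Where M (Throw k N)) (Throw k N)
| r_throw_throw : forall l k N,
    rule (Throw l (Throw k N)) (Throw k N)
| r_where_eps : forall M N,
    rule (Where M (Eps N))
         (Eps (Where (klift 0 M) (csubst (klift 0 M) 0 N)))
| r_throw_eps : forall l M,
    rule (Throw l (Eps M)) (Throw l (krename 0 l M))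
| r_eps_eps : forall M,
    rule (Eps (Eps M)) (Eps (krename 0 0 M)).

Definition step (M N : term) : Prop :=
  exists M' N', sequiv M M' /\ compat rule M' N' /\ sequiv N' N.

Definition reds : relation term :=
  clos_refl_trans term (fun M N => step M N \/ sequiv M N).

Definition conv : relation term :=
  clos_refl_sym_trans term (fun M N => step M N \/ sequiv M N).

(* Main.v *)
Require Import Defs.
From Stdlib Require Import Arith Relations.
From Stdlib Require Import Bool Lia Setoid Morphisms.

(* The calculus is compared with a target calculus of values W, computations C,
   statements S and continuations K,
     W ::= x | \x.C    C ::= \k.S | WW    S ::= KW | CK    K ::= k | \x.S,
   whose beta-eta reduction is confluent because all critical pairs are trivial.
   A CPS translation [cps] maps convertible terms to beta-eta-convertible ones,
   hence to terms with a common reduct. Conversely, [rd] reads \k.S as an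
   exception block, K = k as throw_k [], and K = \x.S as (S where x := []). If
   the superfluous throw and eps are removed while reading, then M reduces to
   [rd (cps M)], and every beta-eta step becomes a reduction of the readings. So
   the reading of the common reduct joins the two given terms. *)

(** * The target calculus *)

Inductive space := Ord | Cont.

(* The three abstractions of the target are [Fun] = \x.C (a value),
   [Bnd] = \x.S (a continuation) and [Ctl] = \k.S (a computation), where the
   statements S are the applications KW ([Bnd]) and CK ([Ctl]), and WW ([Fun])
   is a computation. *)
Inductive kind := Fun | Bnd | Ctl.

Definition dom (a : kind) : space := match a with Ctl => Cont | _ => Ord end.

(** Raw syntax: the sorts are imposed later by [wf], since confluence holds without them. Marking
    abstractions and applications with the same kind makes the three beta-eta pairs instances of one
    schema. *)
Inductive tm : Type :=
| V : space -> nat -> tm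
| L : kind -> tm -> tm
| A : kind -> tm -> tm -> tm.

Definition shift (b c : space) (n : nat) : nat :=
  match b, c with
  | Ord, Ord | Cont, Cont => S n
  | _, _ => n
  end.

Definition upr (b : space) (xi : space -> nat -> nat) (c : space) (n : nat) : nat :=
  match b, c with
  | Ord, Ord | Cont, Cont => match n with 0 => 0 | S m => S (xi c m) end
  | _, _ => xi c n
  end.

Fixpoint ren (xi : space -> nat -> nat) (t : tm) : tm :=
  match t with
  | V b n => V b (xi b n)
  | L a t => L a (ren (upr (dom a) xi) t)
  | A a t u => A a (ren xi t) (ren xi u)
  end.

Notation sh b := (ren (shift b)).

Definition up (b : space) (s : space -> nat -> tm) (c : space) (n : nat) : tm :=
  match b, c with
  | Ord, Ord | Cont, Cont => match n with 0 => V c 0 | S m => sh b (s c m) end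
  | _, _ => sh b (s c n)
  end.

Fixpoint sub (s : space -> nat -> tm) (t : tm) : tm :=
  match t with
  | V b n => s b n
  | L a t => L a (sub (up (dom a) s) t)
  | A a t u => A a (sub s t) (sub s u)
  end.

Definition inst (b : space) (u : tm) (c : space) (n : nat) : tm :=
  match b, c with
  | Ord, Ord | Cont, Cont => match n with 0 => u | S m => V c m end
  | _, _ => V c n
  end.

(** * Fusion laws for renaming and substitution in the target *)

Lemma ren_ext t : forall xi zeta, (forall b n, xi b n = zeta b n) -> ren xi t = ren zeta t.
Proof.
  induction t as [b n|a t IH|a t IH u IHu]; intros xi zeta H; simpl; auto; f_equal; auto.
  apply IH; intros c n; unfold upr; destruct (dom a), c, n; auto.
Qed.

Lemma ren_ren t : forall xi zeta rho, (forall b n, zeta b (xi b n) = rho b n) ->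
  ren zeta (ren xi t) = ren rho t.
Proof.
  induction t as [b n|a t IH|a t IH u IHu]; intros xi zeta rho H; simpl; auto; f_equal; auto.
  apply IH; intros c n; unfold upr; destruct (dom a), c, n; simpl; auto.
Qed.

Lemma sub_ext t : forall s r, (forall b n, s b n = r b n) -> sub s t = sub r t.
Proof.
  induction t as [b n|a t IH|a t IH u IHu]; intros s r H; simpl; auto; f_equal; auto.
  apply IH; intros c n; unfold up; destruct (dom a), c, n; rewrite ?H; auto.
Qed.

Lemma sub_id t : forall s, (forall b n, s b n = V b n) -> sub s t = t.
Proof.
  induction t as [b n|a t IH|a t IH u IHu]; intros s H; simpl; auto; f_equal; auto.
  apply IH; intros c n; unfold up; destruct (dom a), c, n; rewrite ?H; auto.
Qed.

Lemma ren_as_sub t : forall xi, ren xi t = sub (fun b n => V b (xi b n)) t.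
Proof.
  induction t as [b n|a t IH|a t IH u IHu]; intros xi; simpl; auto; f_equal; auto.
  rewrite IH; apply sub_ext; intros c n; unfold up, upr.
  destruct (dom a), c, n; auto.
Qed.

Lemma sub_ren t : forall xi s r, (forall b n, s b (xi b n) = r b n) ->
  sub s (ren xi t) = sub r t.
Proof.
  induction t as [b n|a t IH|a t IH u IHu]; intros xi s r H; simpl; auto; f_equal; auto.
  apply IH; intros c n; unfold up, upr; destruct (dom a), c, n; simpl; rewrite ?H; auto.
Qed.

Lemma ren_up b xi t : ren (upr b xi) (sh b t) = sh b (ren xi t).
Proof.
  rewrite (ren_ren t _ _ (fun c n => shift b c (xi c n))).
  - symmetry; apply ren_ren; auto.
  - intros c n; destruct b, c; auto.
Qed.

Lemma ren_sub t : forall xi s r, (forall b n, ren xi (s b n) = r b n) ->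
  ren xi (sub s t) = sub r t.
Proof.
  induction t as [b n|a t IH|a t IH u IHu]; intros xi s r H; simpl; auto; f_equal; auto.
  apply IH; intros c n; unfold up.
  destruct (dom a), c, n; simpl; auto; rewrite ren_up, H; auto.
Qed.

Lemma sub_up b s t : sub (up b s) (sh b t) = sh b (sub s t).
Proof.
  rewrite (sub_ren t _ _ (fun c n => sh b (s c n))).
  - symmetry; apply ren_sub; auto.
  - intros c n; destruct b, c; auto.
Qed.

Lemma sub_sub t : forall s r q, (forall b n, sub r (s b n) = q b n) ->
  sub r (sub s t) = sub q t.
Proof.
  induction t as [b n|a t IH|a t IH u IHu]; intros s r q H; simpl; auto; f_equal; auto.
  apply IH; intros c n.
  destruct (dom a), c, n; try reflexivity;
    (etransitivity; [apply sub_up|simpl; rewrite H; reflexivity]).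
Qed.

Lemma sub_inst_sh b u t : sub (inst b u) (sh b t) = t.
Proof.
  rewrite (sub_ren t _ _ V); [now apply sub_id|].
  intros c n; destruct b, c; auto.
Qed.

Lemma ren_inst b xi t u :
  ren xi (sub (inst b u) t) = sub (inst b (ren xi u)) (ren (upr b xi) t).
Proof.
  rewrite (ren_sub t _ _ (fun c n => ren xi (inst b u c n))) by auto.
  symmetry; apply sub_ren; intros c n; unfold inst, upr; destruct b, c, n; auto.
Qed.

Lemma sub_inst b s t u :
  sub s (sub (inst b u) t) = sub (inst b (sub s u)) (sub (up b s) t).
Proof.
  rewrite (sub_sub t _ _ (fun c n => sub s (inst b u c n))) by auto.
  symmetry; apply sub_sub; intros c n.
  destruct b, c, n; try reflexivity; apply sub_inst_sh.
Qed.

Lemma ren_up_inst b t : sub (inst b (V b 0)) (ren (upr b (shift b)) t) = t.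
Proof.
  rewrite (sub_ren t _ _ V); [now apply sub_id|].
  intros c n; destruct b, c, n; auto.
Qed.

(* Renamings forming a pullback square of index maps form one on terms. *)
Lemma ren_pullback t : forall u xi zeta xi' zeta',
  (forall b n m, xi b n = zeta b m -> exists p, n = zeta' b p /\ m = xi' b p) ->
  ren xi t = ren zeta u -> exists v, t = ren zeta' v /\ u = ren xi' v.
Proof.
  induction t as [b n|a t IH|a t1 IH1 t2 IH2];
    intros u xi zeta xi' zeta' H E; destruct u as [c m|c u|c u1 u2];
    simpl in E; try discriminate; injection E; intros; subst.
  - destruct (H c n m) as [p [-> ->]]; auto. exists (V c p); auto.
  - destruct (IH u (upr (dom c) xi) (upr (dom c) zeta)
      (upr (dom c) xi') (upr (dom c) zeta')) as [v [-> ->]]; auto.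
    + intros b n m E'; unfold upr in *.
      destruct (dom c), b, n as [|n], m as [|m]; try discriminate;
        try (now exists 0); try (now apply H);
        injection E'; intros E''; destruct (H _ _ _ E'') as [p [-> ->]]; now exists (S p).
    + exists (L c v); auto.
  - destruct (IH1 u1 xi zeta xi' zeta') as [v1 [-> ->]]; auto.
    destruct (IH2 u2 xi zeta xi' zeta') as [v2 [-> ->]]; auto.
    exists (A c v1 v2); auto.
Qed.

Lemma sh_inj b t u : sh b t = sh b u -> t = u.
Proof.
  intros E; rewrite <- (sub_inst_sh b (V b 0) t), E; apply sub_inst_sh.
Qed.

(** * Parallel reduction and confluence of the target *)

Inductive tred : relation tm :=
| t_beta : forall a t u, tred (A a (L a t) u) (sub (inst (dom a) u) t)
| t_eta : forall a t, tred (L a (A a (sh (dom a) t) (V (dom a) 0))) t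
| t_lam : forall a t t', tred t t' -> tred (L a t) (L a t')
| t_appl : forall a t t' u, tred t t' -> tred (A a t u) (A a t' u)
| t_appr : forall a t u u', tred u u' -> tred (A a t u) (A a t u').

Inductive par : relation tm :=
| p_var : forall b n, par (V b n) (V b n)
| p_lam : forall a t t', par t t' -> par (L a t) (L a t')
| p_app : forall a t t' u u', par t t' -> par u u' -> par (A a t u) (A a t' u')
| p_beta : forall a t t' u u', par t t' -> par u u' ->
    par (A a (L a t) u) (sub (inst (dom a) u') t')
| p_eta : forall a t t', par t t' ->
    par (L a (A a (sh (dom a) t) (V (dom a) 0))) t'.

Lemma par_refl t : par t t.
Proof. induction t; constructor; auto. Qed.

Lemma tred_par t t' : tred t t' -> par t t'.
Proof. induction 1; constructor; auto using par_refl. Qed.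

Notation treds := (clos_refl_trans tm tred).

Lemma treds_map (f : tm -> tm) :
  (forall t t', tred t t' -> tred (f t) (f t')) ->
  forall t t', treds t t' -> treds (f t) (f t').
Proof.
  intros H; induction 1; [apply rt_step|apply rt_refl|eapply rt_trans]; eauto.
Qed.

Lemma treds_app a t t' u u' :
  treds t t' -> treds u u' -> treds (A a t u) (A a t' u').
Proof.
  intros H1 H2; apply rt_trans with (A a t' u).
  - apply (treds_map (fun t => A a t u)); auto using t_appl.
  - apply (treds_map (A a t')); auto using t_appr.
Qed.

Lemma par_treds t t' : par t t' -> treds t t'.
Proof.
  induction 1.
  - apply rt_refl.
  - apply treds_map; auto using t_lam.
  - apply treds_app; auto.
  - eapply rt_trans; [|apply rt_step, t_beta].
    apply treds_app; auto. apply treds_map; auto using t_lam.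
  - eapply rt_trans; [apply rt_step, t_eta|auto].
Qed.

Lemma par_ren t t' : par t t' -> forall xi, par (ren xi t) (ren xi t').
Proof.
  induction 1; intros xi; simpl; try (constructor; auto; fail).
  - rewrite ren_inst; constructor; auto.
  - rewrite ren_up.
    replace (upr (dom a) xi (dom a) 0) with 0 by (destruct a; auto).
    constructor; auto.
Qed.

Lemma par_sub t t' : par t t' -> forall s s', (forall b n, par (s b n) (s' b n)) ->
  par (sub s t) (sub s' t').
Proof.
  assert (Hup : forall b s s', (forall b n, par (s b n) (s' b n)) ->
    forall c n, par (up b s c n) (up b s' c n)).
  { intros b s s' H c n; unfold up; destruct b, c, n; auto using par_ren, par_refl. }
  induction 1; intros s s' H'; simpl; auto; try (constructor; auto; fail).
  - rewrite sub_inst; constructor; auto.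
  - rewrite sub_up.
    replace (up (dom a) s (dom a) 0) with (V (dom a) 0) by (destruct a; auto).
    constructor; auto.
Qed.

Lemma par_inst b t t' u u' : par t t' -> par u u' ->
  par (sub (inst b u) t) (sub (inst b u') t').
Proof.
  intros H1 H2; apply par_sub; auto.
  intros c n; unfold inst; destruct b, c, n; auto using par_refl.
Qed.

(** Reduction creates no free variable. With [xi] a shift, this says that an eta redex stays an eta
    redex when its function part reduces. *)
Lemma par_ren_inv t t' : par t t' -> forall xi t0, t = ren xi t0 ->
  exists t0', t' = ren xi t0' /\ par t0 t0'.
Proof.
  induction 1 as [b n|a t t' H IH|a t t' u u' H1 IH1 H2 IH2|a t t' u u' H1 IH1 H2 IH2|a t t' H IH];
    intros xi t0 E; destruct t0 as [c m|c t0|c t1 t2]; try discriminate; simpl in E.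
  - exists (V c m); rewrite E; split; auto using par_refl.
  - injection E as -> E.
    destruct (IH _ _ E) as [t0' [-> ?]].
    exists (L c t0'); split; auto; constructor; auto.
  - injection E as -> E1 E2.
    destruct (IH1 _ _ E1) as [t1' [-> ?]], (IH2 _ _ E2) as [t2' [-> ?]].
    exists (A c t1' t2'); split; auto; constructor; auto.
  - injection E as -> E1 E2.
    destruct t1 as [|c' t1|]; try discriminate; injection E1 as <- E1.
    destruct (IH1 _ _ E1) as [t1' [-> ?]], (IH2 _ _ E2) as [t2' [-> ?]].
    exists (sub (inst (dom c) t2') t1'); split; [symmetry; apply ren_inst|].
    constructor; auto.
  - injection E as -> E.
    destruct t0 as [| |c' t1 t2]; try discriminate; injection E as <- E1 E2.
    destruct t2 as [c0 m| |]; try discriminate; injection E2 as <- E2.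
    assert (m = 0) as -> by (destruct c, m; simpl in *; congruence).
    (* The lifted renaming neither hits nor hides the bound index: if the renamed function part
       avoids index 0, so did the original one, which is therefore itself a shift. *)
    assert (P : forall b n m, upr (dom c) xi b n = shift (dom c) b m ->
      exists p, n = shift (dom c) b p /\ m = xi b p).
    { intros b n m; unfold upr, shift; destruct (dom c), b; try (intros <-; now exists n);
        destruct n as [|n]; try discriminate;
        intros E'; injection E' as <-; now exists n. }
    destruct (ren_pullback _ _ _ _ _ _ P (eq_sym E1)) as [v [-> E3]].
    destruct (IH _ _ E3) as [v' [-> ?]].
    exists v'; split; auto; constructor; auto.
Qed.

Lemma par_app_inv a t u s : par (A a t u) s ->
  (exists t' u', s = A a t' u' /\ par t t' /\ par u u') \/
  (exists t0 t' u', t = L a t0 /\ s = sub (inst (dom a) u') t' /\ par t0 t' /\ par u u').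
Proof. intros H; inversion H; subst; [left|right]; eauto 8. Qed.

Lemma par_lam_inv a t s : par (L a t) s ->
  (exists t', s = L a t' /\ par t t') \/
  (exists t0, t = A a (sh (dom a) t0) (V (dom a) 0) /\ par t0 s).
Proof. intros H; inversion H; subst; eauto. Qed.

(** The second alternative is the overlap of eta with a beta redex in its body: a shifted
    abstraction applied to its own bound variable gives back the abstracted body. *)
Lemma par_eta_body a t s : par (A a (sh (dom a) t) (V (dom a) 0)) s ->
  (exists t', s = A a (sh (dom a) t') (V (dom a) 0) /\ par t t') \/
  (exists u, t = L a u /\ par u s).
Proof.
  intros H; destruct (par_app_inv _ _ _ _ H)
    as [(t' & u' & -> & H1 & H2)|(t0 & t' & u' & E & -> & H1 & H2)]; inversion H2; subst.
  - left; destruct (par_ren_inv _ _ H1 _ _ eq_refl) as [t0 [-> ?]]; eauto.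
  - right; destruct t as [|c t|]; try discriminate; injection E as -> <-.
    destruct (par_ren_inv _ _ H1 _ _ eq_refl) as [t0 [-> ?]].
    exists t; rewrite ren_up_inst; auto.
Qed.

Fixpoint tsize (t : tm) : nat :=
  match t with
  | V _ _ => 0
  | L _ t => S (tsize t)
  | A _ t u => S (tsize t + tsize u)
  end.

Lemma tsize_ren t : forall xi, tsize (ren xi t) = tsize t.
Proof. induction t; intros; simpl; auto. Qed.

(** Induction on size, since recursive calls are made on [t] where only [sh t] occurs as a subterm,
    and on the reassembled application [A a t0 u]. *)
Lemma par_diamond n : forall t, tsize t < n -> forall t1 t2, par t t1 -> par t t2 ->
  exists t3, par t1 t3 /\ par t2 t3.
Proof.
  induction n as [|n IH]; [lia|].
  (* Eta at the root against a step in the body. If that step is a beta contraction, both results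
     are reducts of the same abstraction [L a u], which is [t]. *)
  assert (Leta : forall a t s t', tsize t + 1 < n -> par t t' ->
    par (A a (sh (dom a) t) (V (dom a) 0)) s -> exists v, par (L a s) v /\ par t' v).
  { intros a t s t' Hs H1 H2.
    destruct (par_eta_body _ _ _ H2) as [[t0 [-> H]]|[u [-> H]]].
    - destruct (IH t ltac:(lia) _ _ H H1) as [v [? ?]].
      exists v; split; auto; constructor; auto.
    - apply (IH (L a u) ltac:(lia)); auto; constructor; auto. }
  (* Beta at the root against steps in function and argument. If the function is contracted by eta,
     both results are reducts of the smaller term [A a t0 u]. *)
  assert (Lbeta : forall a t u t1 t2 u1 u2, tsize t + tsize u + 1 < n ->
    par (L a t) t1 -> par t t2 -> par u u1 -> par u u2 ->
    exists v, par (A a t1 u1) v /\ par (sub (inst (dom a) u2) t2) v).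
  { intros a t u t1 t2 u1 u2 Hs H1 H2 H3 H4.
    destruct (par_lam_inv _ _ _ H1) as [(t' & -> & H)|(t0 & -> & H)].
    - destruct (IH t ltac:(lia) _ _ H H2) as [v [? ?]].
      destruct (IH u ltac:(lia) _ _ H3 H4) as [w [? ?]].
      exists (sub (inst (dom a) w) v); split; [constructor; auto|apply par_inst; auto].
    - simpl in Hs; rewrite tsize_ren in Hs.
      apply (IH (A a t0 u)); [simpl; lia|constructor; auto|].
      destruct (par_eta_body _ _ _ H2) as [[t' [-> H']]|[t' [-> H']]].
      + simpl; rewrite sub_inst_sh.
        replace (inst (dom a) u2 (dom a) 0) with u2 by (destruct a; auto).
        constructor; auto.
      + constructor; auto. }
  intros [b m|a t|a t u] Hs t1 t2 H1 H2; simpl in Hs.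
  - inversion H1; inversion H2; subst; eauto using par_refl.
  - destruct (par_lam_inv _ _ _ H1) as [(t1' & -> & H1')|(u1 & -> & H1')],
      (par_lam_inv _ _ _ H2) as [(t2' & E & H2')|(u2 & E & H2')]; subst.
    + destruct (IH t ltac:(lia) _ _ H1' H2') as [v [? ?]].
      exists (L a v); split; constructor; auto.
    + simpl in Hs; rewrite tsize_ren in Hs; eapply Leta; eauto; lia.
    + simpl in Hs; rewrite tsize_ren in Hs.
      destruct (Leta a u1 t2' t1) as [v [? ?]]; eauto; lia.
    + simpl in Hs; rewrite tsize_ren in Hs.
      injection E as E; apply sh_inj in E; subst.
      apply (IH u2); auto; lia.
  - destruct (par_app_inv _ _ _ _ H1)
      as [(t1' & u1 & -> & P1 & Q1)|(t0 & t1' & u1 & -> & -> & P1 & Q1)],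
      (par_app_inv _ _ _ _ H2)
      as [(t2' & u2 & -> & P2 & Q2)|(t0' & t2' & u2 & E & -> & P2 & Q2)];
      try (injection E as <-); subst; simpl in Hs;
      destruct (IH u ltac:(lia) _ _ Q1 Q2) as [w [? ?]].
    + destruct (IH t ltac:(lia) _ _ P1 P2) as [v [? ?]].
      exists (A a v w); split; constructor; auto.
    + simpl in Hs; eapply Lbeta; eauto; lia.
    + destruct (Lbeta a t0 u t2' t1' u2 u1) as [v [? ?]]; eauto; lia.
    + destruct (IH t0 ltac:(lia) _ _ P1 P2) as [v [? ?]].
      exists (sub (inst (dom a) w) v); split; apply par_inst; auto.
Qed.

Notation tconv := (clos_refl_sym_trans tm tred).

Lemma pars_strip t t1 t2 : par t t1 -> clos_refl_trans tm par t t2 ->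
  exists t3, clos_refl_trans tm par t1 t3 /\ par t2 t3.
Proof.
  intros H1 H2; apply clos_rt_rt1n in H2; revert t1 H1.
  induction H2 as [t|t t' t2 H _ IH]; intros t1 H1.
  - exists t1; split; auto using rt_refl.
  - destruct (par_diamond _ t (Nat.lt_succ_diag_r _) _ _ H1 H) as [u [Hu1 Hu2]].
    destruct (IH _ Hu2) as [v [? ?]].
    exists v; split; auto; eapply rt_trans; [apply rt_step|]; eauto.
Qed.

Lemma pars_confluent t t1 t2 : clos_refl_trans tm par t t1 -> clos_refl_trans tm par t t2 ->
  exists t3, clos_refl_trans tm par t1 t3 /\ clos_refl_trans tm par t2 t3.
Proof.
  intros H1 H2; apply clos_rt_rt1n in H1; revert t2 H2.
  induction H1 as [t|t t' t1 H _ IH]; intros t2 H2.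
  - exists t2; split; auto using rt_refl.
  - destruct (pars_strip _ _ _ H H2) as [u [Hu1 Hu2]].
    destruct (IH _ Hu1) as [v [? ?]].
    exists v; split; auto; eapply rt_trans; [apply rt_step|]; eauto.
Qed.

Lemma treds_pars t t' : treds t t' <-> clos_refl_trans tm par t t'.
Proof.
  split; induction 1; eauto using rt_refl, rt_trans, rt_step, tred_par, par_treds.
Qed.

Lemma tconv_church_rosser t1 t2 : tconv t1 t2 -> exists t3, treds t1 t3 /\ treds t2 t3.
Proof.
  induction 1 as [t1 t2 H|t|t1 t2 _ [u [? ?]]|t1 t2 t3 _ [u [H1 H2]] _ [v [H3 H4]]].
  - exists t2; split; auto using rt_refl, rt_step.
  - exists t; split; apply rt_refl.
  - exists u; auto.
  - rewrite treds_pars in H2, H3.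
    destruct (pars_confluent _ _ _ H2 H3) as [w [? ?]].
    exists w; split; eapply rt_trans; eauto; apply treds_pars; auto.
Qed.

(** * Simultaneous substitution in the source calculus *)

(** One renaming on both index spaces covers [lift], [klift] and [krename], as [msub] below covers
    [subst] and [csubst]; commutation laws are then proved once and without cutoffs. *)
Fixpoint sren (xi : space -> nat -> nat) (M : term) : term :=
  match M with
  | Var n => Var (xi Ord n)
  | Lam M => Lam (sren (upr Ord xi) M)
  | App M N => App (sren xi M) (sren xi N)
  | Where P N => Where (sren (upr Ord xi) P) (sren xi N)
  | Eps M => Eps (sren (upr Cont xi) M)
  | Throw k M => Throw (xi Cont k) (sren xi M)
  end.

(** [None] is the bare hole, distinct from [(x where x := [])]: a mere renaming of continuation
    variables must not insert a frame. *)
Definition plug (f : option term) (M : term) : term :=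
  match f with Some P => Where P M | None => M end.

Definition up_ord_val (s : nat -> term) (n : nat) : term :=
  match n with 0 => Var 0 | S m => sren (shift Ord) (s m) end.

(* The frame [P] of [(P where x := [])] lives under its own binder. *)
Definition up_ord_frame (th : nat -> nat * option term) (k : nat) : nat * option term :=
  (fst (th k), option_map (sren (upr Ord (shift Ord))) (snd (th k))).

Definition up_cont_val (s : nat -> term) (n : nat) : term := sren (shift Cont) (s n).

Definition up_cont_frame (th : nat -> nat * option term) (k : nat) : nat * option term :=
  match k with
  | 0 => (0, None)
  | S k => (S (fst (th k)), option_map (sren (shift Cont)) (snd (th k)))
  end.

(* [th k = (j, Some P)] replaces [throw_k []] by [throw_j (P where x := [])],
   and [th k = (j, None)] replaces it by [throw_j []]. *)
Fixpoint msub (s : nat -> term) (th : nat -> nat * option term) (M : term) : term :=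
  match M with
  | Var n => s n
  | Lam M => Lam (msub (up_ord_val s) (up_ord_frame th) M)
  | App M N => App (msub s th M) (msub s th N)
  | Where P N => Where (msub (up_ord_val s) (up_ord_frame th) P) (msub s th N)
  | Eps M => Eps (msub (up_cont_val s) (up_cont_frame th) M)
  | Throw k M => Throw (fst (th k)) (plug (snd (th k)) (msub s th M))
  end.

Fixpoint kfree (i : nat) (M : term) : bool :=
  match M with
  | Var _ => false
  | Lam M => kfree i M
  | App M N => kfree i M || kfree i N
  | Where P N => kfree i P || kfree i N
  | Eps M => kfree (S i) M
  | Throw k M => (k =? i) || kfree i M
  end.

(** Agreement on continuation variables is asked only at the free ones: a vacuous binder is removed
    by renaming its index to an arbitrary value. *)
Lemma sren_ext M : forall xi zeta, (forall n, xi Ord n = zeta Ord n) ->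
  (forall k, kfree k M = true -> xi Cont k = zeta Cont k) -> sren xi M = sren zeta M.
Proof.
  induction M as [n|M IH|M IHM N IHN|P IHP N IHN|M IH|k M IH]; simpl;
    intros xi zeta Ho Hc; auto; f_equal; auto;
    try (apply IHM || apply IHN || apply IHP || apply IH); auto;
    try (intros [|n]; simpl; auto; fail);
    try (intros i Hi; apply Hc; rewrite Hi, ?orb_true_r; auto; fail).
  apply Hc; rewrite Nat.eqb_refl; auto.
Qed.

Lemma sren_id M : forall xi, (forall b n, xi b n = n) -> sren xi M = M.
Proof.
  induction M as [n|M IH|M IHM N IHN|P IHP N IHN|M IH|k M IH]; simpl;
    intros xi H; auto; f_equal; auto;
    try (apply IHM || apply IHN || apply IHP || apply IH); auto;
    intros [] [|n]; simpl; auto.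
Qed.

Lemma sren_sren M : forall xi zeta rho, (forall b n, zeta b (xi b n) = rho b n) ->
  sren zeta (sren xi M) = sren rho M.
Proof.
  induction M as [n|M IH|M IHM N IHN|P IHP N IHN|M IH|k M IH]; simpl;
    intros xi zeta rho H; auto; f_equal; auto;
    try (apply IHM || apply IHN || apply IHP || apply IH); auto;
    intros [] [|n]; simpl; auto.
Qed.

Lemma sren_up b xi M : sren (upr b xi) (sren (shift b) M) = sren (shift b) (sren xi M).
Proof.
  rewrite (sren_sren M _ _ (fun c n => shift b c (xi c n))).
  - symmetry; apply sren_sren; auto.
  - intros c n; destruct b, c; auto.
Qed.

Lemma sren_up_frame xi P :
  sren (upr Ord (upr Ord xi)) (sren (upr Ord (shift Ord)) P) =
  sren (upr Ord (shift Ord)) (sren (upr Ord xi) P).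
Proof.
  rewrite (sren_sren P _ _ (fun c n => upr Ord (shift Ord) c (upr Ord xi c n))).
  - symmetry; apply sren_sren; auto.
  - intros [] [|n]; auto.
Qed.

Lemma sren_up_cont xi P :
  sren (upr Ord (upr Cont xi)) (sren (shift Cont) P) =
  sren (shift Cont) (sren (upr Ord xi) P).
Proof.
  rewrite (sren_sren P _ _ (fun c n => shift Cont c (upr Ord xi c n))).
  - symmetry; apply sren_sren; auto.
  - intros [] [|n]; auto.
Qed.

Lemma msub_ext M : forall s s' th th', (forall n, s n = s' n) ->
  (forall k, kfree k M = true -> th k = th' k) -> msub s th M = msub s' th' M.
Proof.
  induction M as [n|M IH|M IHM N IHN|P IHP N IHN|M IH|k M IH]; simpl;
    intros s s' th th' Ho Hc; auto; f_equal; auto;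
    try (apply IHM || apply IHN || apply IHP || apply IH); auto;
    try (intros [|n]; simpl; rewrite ?Ho; auto; fail);
    try (intros i Hi; unfold up_ord_frame; rewrite Hc; auto; rewrite Hi, ?orb_true_r; auto; fail).
  - intros n; unfold up_cont_val; rewrite Ho; auto.
  - intros [|i] Hi; simpl; auto; rewrite Hc; auto.
  - rewrite Hc; auto; rewrite Nat.eqb_refl; auto.
  - f_equal; [rewrite Hc; auto; rewrite Nat.eqb_refl; auto|].
    apply IH; auto. intros i Hi; apply Hc; rewrite Hi, orb_true_r; auto.
Qed.

Lemma sren_as_msub M : forall xi,
  sren xi M = msub (fun n => Var (xi Ord n)) (fun k => (xi Cont k, None)) M.
Proof.
  induction M as [n|M IH|M IHM N IHN|P IHP N IHN|M IH|k M IH]; simpl;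
    intros xi; auto; f_equal; auto; rewrite ?IH, ?IHP;
    apply msub_ext; try (intros [|i]; reflexivity); intros [|i] _; reflexivity.
Qed.

Lemma msub_sren M : forall xi s th r ph, (forall n, s (xi Ord n) = r n) ->
  (forall k, th (xi Cont k) = ph k) -> msub s th (sren xi M) = msub r ph M.
Proof.
  induction M as [n|M IH|M IHM N IHN|P IHP N IHN|M IH|k M IH]; simpl;
    intros xi s th r ph Ho Hc; rewrite ?Hc; auto; f_equal; auto;
    try (apply IHM || apply IHN || apply IHP || apply IH); auto;
    try (intros [|n]; simpl; rewrite ?Ho; auto; fail);
    try (intros i; unfold up_ord_frame, up_cont_val; simpl; rewrite ?Hc, ?Ho; auto; fail).
  - intros [|i]; simpl; rewrite ?Hc; auto.
  - f_equal; auto.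
Qed.

Lemma sren_msub M : forall xi s th r ph, (forall n, sren xi (s n) = r n) ->
  (forall k, ph k = (xi Cont (fst (th k)), option_map (sren (upr Ord xi)) (snd (th k)))) ->
  sren xi (msub s th M) = msub r ph M.
Proof.
  induction M as [n|M IH|M IHM N IHN|P IHP N IHN|M IH|k M IH]; simpl;
    intros xi s th r ph Ho Hc; rewrite ?Hc; auto; f_equal; auto;
    try (apply IHM || apply IHN || apply IHP || apply IH); auto;
    try (intros [|n]; simpl; auto; rewrite sren_up, Ho; auto; fail);
    try (intros i; unfold up_ord_frame; simpl; rewrite Hc; simpl; f_equal;
      destruct (snd (th i)); simpl; rewrite ?sren_up_frame; auto; fail).
  - intros n; unfold up_cont_val; rewrite sren_up, Ho; auto.
  - intros [|i]; simpl; auto; rewrite Hc; simpl; f_equal.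
    destruct (snd (th i)); simpl; rewrite ?sren_up_cont; auto.
  - simpl; rewrite <- (IH xi s th r ph); auto.
    destruct (snd (th k)); auto.
Qed.

Lemma kfree_sren M : forall xi i j, (forall k, (xi Cont k =? j) = (k =? i)) ->
  kfree j (sren xi M) = kfree i M.
Proof.
  induction M as [n|M IH|M IHM N IHN|P IHP N IHN|M IH|k M IH]; simpl; intros xi i j H; auto.
  - rewrite (IHM xi i j), (IHN xi i j); auto.
  - rewrite (IHP (upr Ord xi) i j), (IHN xi i j); auto.
  - apply IH; intros [|k]; simpl; auto.
  - rewrite H, (IH xi i j); auto.
Qed.

Lemma kfree_sren_inv M : forall xi j, kfree j (sren xi M) = true ->
  exists i, kfree i M = true /\ xi Cont i = j.
Proof.
  induction M as [n|M IH|M IHM N IHN|P IHP N IHN|M IH|k M IH]; simpl; intros xi j H.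
  - discriminate.
  - apply IH in H; auto.
  - apply orb_prop in H; destruct H as [H|H]; [apply IHM in H|apply IHN in H];
      destruct H as (i & H & <-); exists i; rewrite H, ?orb_true_r; auto.
  - apply orb_prop in H; destruct H as [H|H]; [apply IHP in H|apply IHN in H];
      destruct H as (i & H & <-); exists i; rewrite H, ?orb_true_r; auto.
  - apply IH in H; destruct H as ([|i] & H & E); simpl in E; [discriminate|].
    injection E as <-; eauto.
  - apply orb_prop in H; destruct H as [H|H].
    + apply Nat.eqb_eq in H; exists k; rewrite Nat.eqb_refl; auto.
    + apply IH in H; destruct H as (i & H & <-); exists i; rewrite H, ?orb_true_r; auto.
Qed.

(* The ways a free continuation variable [j] of [msub s th M] can arise, [Q]
   being the set of free continuation variables of [M]. *)
Definition kfree_source (s : nat -> term) (th : nat -> nat * option term)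
    (j : nat) (Q : nat -> Prop) : Prop :=
  (exists i, Q i /\ (fst (th i) = j \/
     exists P, snd (th i) = Some P /\ kfree j P = true)) \/
  (exists n, kfree j (s n) = true).

Lemma kfree_source_mono s th j (Q Q' : nat -> Prop) : (forall i, Q i -> Q' i) ->
  kfree_source s th j Q -> kfree_source s th j Q'.
Proof. intros HQ [(i & Hi & H)|H]; [left|right]; eauto. Qed.

Lemma kfree_source_up_ord s th j Q :
  kfree_source (up_ord_val s) (up_ord_frame th) j Q -> kfree_source s th j Q.
Proof.
  intros [(i & Hi & [H|(P & H1 & H2)])|([|n] & H)]; simpl in *.
  - left; eauto.
  - left; exists i; split; auto; right; destruct (snd (th i)) as [P'|]; [|discriminate].
    injection H1 as <-; exists P'; split; auto.
    rewrite (kfree_sren _ _ j) in H2; auto.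
  - discriminate.
  - right; exists n; rewrite (kfree_sren _ _ j) in H; auto.
Qed.

Lemma kfree_msub M : forall s th j, kfree j (msub s th M) = true ->
  kfree_source s th j (fun i => kfree i M = true).
Proof.
  induction M as [n|M IH|M IHM N IHN|P IHP N IHN|M IH|k M IH]; simpl; intros s th j H.
  - right; eauto.
  - apply kfree_source_up_ord, IH; auto.
  - apply orb_prop in H; destruct H as [H|H]; [apply IHM in H|apply IHN in H];
      revert H; apply kfree_source_mono; intros i Hi; rewrite Hi, ?orb_true_r; auto.
  - apply orb_prop in H; destruct H as [H|H]; [apply IHP, kfree_source_up_ord in H|apply IHN in H];
      revert H; apply kfree_source_mono; intros i Hi; rewrite Hi, ?orb_true_r; auto.
  - apply IH in H; destruct H as [([|i] & Hi & [H|(P & H1 & H2)])|(n & H)]; simpl in *;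
      try discriminate.
    + left; exists i; split; auto.
    + left; exists i; split; auto; right; destruct (snd (th i)) as [P'|]; [|discriminate].
      injection H1 as <-; exists P'; split; auto.
      rewrite (kfree_sren _ _ j) in H2; auto.
    + right; exists n; unfold up_cont_val in H; rewrite (kfree_sren _ _ j) in H; auto.
  - apply orb_prop in H; destruct H as [H|H].
    + apply Nat.eqb_eq in H; left; exists k; rewrite Nat.eqb_refl; auto.
    + destruct (snd (th k)) as [P|] eqn:E; simpl in H.
      * apply orb_prop in H; destruct H as [H|H].
        -- left; exists k; rewrite Nat.eqb_refl; split; eauto.
        -- apply IH in H; revert H; apply kfree_source_mono; intros i Hi; rewrite Hi, ?orb_true_r; auto.
      * apply IH in H; revert H; apply kfree_source_mono; intros i Hi; rewrite Hi, ?orb_true_r; auto.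
Qed.

(** * The index operations of the calculus as instances of [sren] and [msub] *)

Lemma lift_sren M : forall c xi, (forall n, xi Ord n = if c <=? n then S n else n) ->
  (forall k, xi Cont k = k) -> lift c M = sren xi M.
Proof.
  induction M as [n|M IH|M IHM N IHN|P IHP N IHN|M IH|k M IH]; simpl;
    intros c xi Ho Hc; rewrite ?Hc; auto; f_equal; auto.
  - rewrite Ho; destruct (c <=? n); auto.
  - apply IH; auto; intros [|n]; simpl; auto; rewrite Ho; destruct (c <=? n); auto.
  - apply IHP; auto; intros [|n]; simpl; auto; rewrite Ho; destruct (c <=? n); auto.
  - apply IH; auto; intros [|n]; simpl; auto.
Qed.

Lemma klift_sren M : forall c xi, (forall k, xi Cont k = if c <=? k then S k else k) ->
  (forall n, xi Ord n = n) -> klift c M = sren xi M.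
Proof.
  induction M as [n|M IH|M IHM N IHN|P IHP N IHN|M IH|k M IH]; simpl;
    intros c xi Hc Ho; rewrite ?Ho; auto; f_equal; auto.
  - apply IH; auto; intros [|n]; simpl; auto.
  - apply IHP; auto; intros [|n]; simpl; auto.
  - apply IH; auto; intros [|k]; simpl; auto; rewrite Hc; destruct (c <=? k); auto.
Qed.

Lemma krename_sren M : forall d l xi,
  (forall i, xi Cont i = if i <? d then i else if i =? d then l + d else pred i) ->
  (forall n, xi Ord n = n) -> krename d l M = sren xi M.
Proof.
  induction M as [n|M IH|M IHM N IHN|P IHP N IHN|M IH|k M IH]; simpl;
    intros d l xi Hc Ho; rewrite ?Ho; auto; f_equal; auto.
  - apply IH; auto; intros [|n]; simpl; auto.
  - apply IHP; auto; intros [|n]; simpl; auto.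
  - apply IH; auto; intros [|k]; simpl; auto; rewrite Hc.
    destruct (Nat.ltb_spec k d), (Nat.ltb_spec (S k) (S d)), (Nat.eqb_spec k d); auto; lia.
Qed.

Lemma lift0 M : lift 0 M = sren (shift Ord) M.
Proof. apply lift_sren; auto. Qed.

Lemma lift1 M : lift 1 M = sren (upr Ord (shift Ord)) M.
Proof. apply lift_sren; auto; intros [|n]; auto. Qed.

Lemma klift0 M : klift 0 M = sren (shift Cont) M.
Proof. apply klift_sren; auto. Qed.

Definition kinst (l : nat) (b : space) (n : nat) : nat :=
  match b with Ord => n | Cont => match n with 0 => l | S m => m end end.

Lemma krename0 l M : krename 0 l M = sren (kinst l) M.
Proof. apply krename_sren; auto; intros [|n]; simpl; auto. Qed.

Lemma subst_msub M : forall c W s th,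
  (forall n, s n = if n =? c then W else if c <? n then Var (pred n) else Var n) ->
  (forall k, th k = (k, None)) -> subst c W M = msub s th M.
Proof.
  assert (Hup : forall c W s,
    (forall n, s n = if n =? c then W else if c <? n then Var (pred n) else Var n) ->
    forall n, up_ord_val s n =
      if n =? S c then lift 0 W else if S c <? n then Var (pred n) else Var n).
  { intros c W s Ho [|n]; simpl; auto; rewrite Ho.
    destruct (n =? c); [symmetry; apply lift0|].
    destruct (Nat.ltb_spec c n), (Nat.ltb_spec (S c) (S n)); try lia; auto.
    destruct n; auto; lia. }
  induction M as [n|M IH|M IHM N IHN|P IHP N IHN|M IH|k M IH]; simpl;
    intros c W s th Ho Hc; rewrite ?Hc; auto; f_equal; auto.
  - apply IH; auto; intros k; unfold up_ord_frame; rewrite Hc; auto.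
  - apply IHP; auto; intros k; unfold up_ord_frame; rewrite Hc; auto.
  - apply IH; [|intros [|k]; simpl; rewrite ?Hc; auto].
    intros n; unfold up_cont_val; rewrite Ho, klift0.
    destruct (n =? c), (c <? n); auto.
  - simpl; auto.
Qed.

Definition vinst (W : term) (n : nat) : term := match n with 0 => W | S m => Var m end.

Lemma subst0 W M : subst 0 W M = msub (vinst W) (fun k => (k, None)) M.
Proof. apply subst_msub; auto; intros [|n]; auto. Qed.

Lemma csubst_msub N : forall P k s th, (forall n, s n = Var n) ->
  (forall i, th i = (i, if i =? k then Some P else None)) -> csubst P k N = msub s th N.
Proof.
  induction N as [n|M IH|M IHM N IHN|P' IHP N IHN|M IH|j M IH]; simpl;
    intros P k s th Ho Hc; auto; f_equal; auto.
  - apply IH; [intros [|n]; simpl; rewrite ?Ho; auto|].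
    intros i; unfold up_ord_frame; rewrite Hc, lift1; simpl; destruct (i =? k); auto.
  - apply IHP; [intros [|n]; simpl; rewrite ?Ho; auto|].
    intros i; unfold up_ord_frame; rewrite Hc, lift1; simpl; destruct (i =? k); auto.
  - apply IH; [intros n; unfold up_cont_val; rewrite ?Ho; auto|].
    intros [|i]; simpl; auto; rewrite Hc, klift0; simpl; destruct (i =? k); auto.
  - rewrite Hc; simpl; destruct (j =? k); simpl; auto; f_equal; auto.
    f_equal; auto.
Qed.

Definition cframe (P : term) (i : nat) : nat * option term :=
  (i, if i =? 0 then Some P else None).

Lemma csubst0 P N : csubst P 0 N = msub Var (cframe P) N.
Proof. apply csubst_msub; auto. Qed.

(** * Closure properties of reduction *)

Lemma reds_map (f : term -> term) :
  (forall M N, compat struct_eq M N -> compat struct_eq (f M) (f N)) ->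
  (forall M N, compat rule M N -> compat rule (f M) (f N)) ->
  forall M N, reds M N -> reds (f M) (f N).
Proof.
  intros Hs Hr.
  assert (Hq : forall M N, sequiv M N -> sequiv (f M) (f N)).
  { induction 1; [apply rst_step|apply rst_refl|apply rst_sym|eapply rst_trans]; eauto. }
  induction 1 as [M N [(M' & N' & H1 & H2 & H3)|H]|M|M N P _ IH1 _ IH2].
  - apply rt_step; left; exists (f M'), (f N'); auto.
  - apply rt_step; right; auto.
  - apply rt_refl.
  - eapply rt_trans; eauto.
Qed.

Lemma reds_lam M N : reds M N -> reds (Lam M) (Lam N).
Proof. apply reds_map; apply c_lam. Qed.

Lemma reds_app M M' N N' : reds M M' -> reds N N' -> reds (App M N) (App M' N').
Proof.
  intros H1 H2; apply rt_trans with (App M' N).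
  - apply (reds_map (fun M => App M N)); auto; intros; apply c_appl; auto.
  - apply (reds_map (App M')); auto; intros; apply c_appr; auto.
Qed.

Lemma reds_where M M' N N' : reds M M' -> reds N N' -> reds (Where M N) (Where M' N').
Proof.
  intros H1 H2; apply rt_trans with (Where M' N).
  - apply (reds_map (fun M => Where M N)); auto; intros; apply c_wherel; auto.
  - apply (reds_map (Where M')); auto; intros; apply c_wherer; auto.
Qed.

Lemma reds_eps M N : reds M N -> reds (Eps M) (Eps N).
Proof. apply reds_map; apply c_eps. Qed.

Lemma reds_throw k M N : reds M N -> reds (Throw k M) (Throw k N).
Proof. apply reds_map; apply c_throw. Qed.

Lemma reds_plug f M N : reds M N -> reds (plug f M) (plug f N).
Proof. destruct f; simpl; auto; intros; apply reds_where; auto; apply rt_refl. Qed.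

Lemma rule_reds M N : rule M N -> reds M N.
Proof.
  intros H; apply rt_step; left; exists M, N; split; [apply rst_refl|].
  split; [apply c_base; auto|apply rst_refl].
Qed.

Lemma struct_reds M N : struct_eq M N -> reds M N.
Proof. intros H; apply rt_step; right; apply rst_step, c_base; auto. Qed.

Lemma compat_sren R : (forall M N, R M N -> forall xi, R (sren xi M) (sren xi N)) ->
  forall M N, compat R M N -> forall xi, compat R (sren xi M) (sren xi N).
Proof.
  intros H; induction 1; intros xi; simpl;
    [apply c_base|apply c_lam|apply c_appl|apply c_appr|apply c_wherel|apply c_wherer
    |apply c_eps|apply c_throw]; auto.
Qed.

Lemma struct_eq_sren M N : struct_eq M N -> forall xi, struct_eq (sren xi M) (sren xi N).
Proof.
  intros [P M' N'|M' N'|k M' N'] xi; simpl.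
  - rewrite lift1, sren_up_frame, <- lift1; constructor.
  - rewrite klift0, sren_up, <- klift0.
    replace (sren (upr Ord (upr Cont xi)) M') with (sren (upr Cont (upr Ord xi)) M');
      [constructor|].
    apply sren_ext; auto; intros [|n]; auto.
  - constructor.
Qed.

Lemma is_value_sren M xi : is_value (sren xi M) <-> is_value M.
Proof. destruct M; simpl; tauto. Qed.

(** Needed because vacuous blocks are erased by a renaming, and reductions in their bodies must
    survive it. *)
Lemma rule_sren M N : rule M N -> forall xi, rule (sren xi M) (sren xi N).
Proof.
  intros [N' M' H|W N' H1 H2|M' W H|M' W H|W H|M'|M'|M'|M' k N'|l k N'|M' N'|l M'|M'] xi; simpl.
  - rewrite lift0, sren_up, <- lift0; apply r_appl; rewrite is_value_sren; auto.
  - rewrite lift0, sren_up, <- lift0; apply r_appr; rewrite is_value_sren; auto.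
  - apply r_beta; rewrite is_value_sren; auto.
  - replace (sren xi (subst 0 W M')) with (subst 0 (sren xi W) (sren (upr Ord xi) M')).
    + apply r_where_val; rewrite is_value_sren; auto.
    + rewrite !subst0; erewrite msub_sren; [symmetry; eapply sren_msub| |]; try (intros; reflexivity).
      intros [|n]; reflexivity.
  - rewrite lift0, sren_up, <- lift0; apply r_eta; rewrite is_value_sren; auto.
  - apply r_where_var.
  - rewrite klift0, sren_up, <- klift0; apply r_eps_gc.
  - apply r_eps_throw.
  - apply r_where_throw.
  - apply r_throw_throw.
  - replace (sren (upr Ord (upr Cont xi)) (klift 0 M')) with (klift 0 (sren (upr Ord xi) M')).
    2:{ rewrite !klift0; symmetry; apply sren_up_cont. }
    replace (sren (upr Cont xi) (csubst (klift 0 M') 0 N'))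
      with (csubst (klift 0 (sren (upr Ord xi) M')) 0 (sren (upr Cont xi) N')); [apply r_where_eps|].
    rewrite !csubst0; erewrite msub_sren; [symmetry; eapply sren_msub| |]; try (intros; reflexivity).
    intros [|k]; simpl; auto. rewrite !klift0, sren_up_cont; auto.
  - replace (sren xi (krename 0 l M')) with (krename 0 (xi Cont l) (sren (upr Cont xi) M'));
      [apply r_throw_eps|].
    rewrite !krename0; erewrite sren_sren; [symmetry; eapply sren_sren; intros; reflexivity|].
    intros [] [|n]; auto.
  - replace (sren (upr Cont xi) (krename 0 0 M'))
      with (krename 0 0 (sren (upr Cont (upr Cont xi)) M')); [apply r_eps_eps|].
    rewrite !krename0; erewrite sren_sren; [symmetry; eapply sren_sren; intros; reflexivity|].
    intros [] [|n]; auto.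
Qed.

Lemma reds_sren xi M N : reds M N -> reds (sren xi M) (sren xi N).
Proof.
  apply reds_map; intros; apply compat_sren; auto.
  - apply struct_eq_sren.
  - apply rule_sren.
Qed.

(** * Free continuation variables under reduction *)

Lemma compat_kfree (R : relation bool) (Q : relation term) :
  (forall a b c d, R a b -> R c d -> R (a || c) (b || d)) -> (forall a, R a a) ->
  (forall M N, Q M N -> forall k, R (kfree k M) (kfree k N)) ->
  forall M N, compat Q M N -> forall k, R (kfree k M) (kfree k N).
Proof. intros Ho Hr H; induction 1; intros i; simpl; auto. Qed.

Lemma kfree_lift0 k M : kfree k (lift 0 M) = kfree k M.
Proof. rewrite lift0; apply kfree_sren; auto. Qed.

Lemma kfree_klift0 k M : kfree (S k) (klift 0 M) = kfree k M.
Proof. rewrite klift0; apply kfree_sren; auto. Qed.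

Lemma struct_eq_kfree M N : struct_eq M N -> forall k, kfree k M = kfree k N.
Proof.
  intros [P M' N'|M' N'|j M' N'] k; simpl.
  - rewrite lift1, (kfree_sren P _ k); auto using orb_assoc.
  - rewrite kfree_klift0; auto.
  - symmetry; apply orb_assoc.
Qed.

Lemma kfree_kinst l k M : kfree k (sren (kinst l) M) = true -> l = k \/ kfree (S k) M = true.
Proof.
  intros H; destruct (kfree_sren_inv _ _ _ H) as ([|i] & H1 & H2); simpl in H2; subst; auto.
Qed.

Lemma rule_kfree M N : rule M N -> forall k, kfree k N = true -> kfree k M = true.
Proof.
  intros [N' M' H|W N' H1 H2|M' W H|M' W H|W H|M'|M'|M'|M' j N'|l j N'|M' N'|l M'|M'] k; simpl;
    rewrite ?kfree_lift0, ?kfree_klift0, ?orb_false_r, ?orb_true_iff; try tauto.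
  - rewrite subst0; intros H'; destruct (kfree_msub _ _ _ _ H')
      as [(i & Hi & [H1|(P & H1 & H2)])|([|n] & H1)]; simpl in *; try discriminate; subst; auto.
  - rewrite csubst0; intros [H|H]; auto.
    destruct (kfree_msub _ _ _ _ H) as [(i & Hi & [H1|(P & H1 & H2)])|(n & H1)];
      simpl in *; subst; auto; try discriminate.
    destruct (i =? 0); [|discriminate]; injection H1 as <-.
    rewrite kfree_klift0 in H2; auto.
  - rewrite krename0; intros [H|H]; auto.
    destruct (kfree_kinst _ _ _ H) as [->|H']; auto. left; apply Nat.eqb_refl.
  - rewrite krename0; intros H; destruct (kfree_kinst _ _ _ H) as [H'|H']; auto; discriminate.
Qed.

Lemma reds_kfree M N : reds M N -> forall k, kfree k N = true -> kfree k M = true.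
Proof.
  assert (Hq : forall M N, sequiv M N -> forall k, kfree k M = kfree k N).
  { induction 1; intros k; try congruence.
    revert k; apply (compat_kfree eq struct_eq); auto using struct_eq_kfree.
    intros; congruence. }
  induction 1 as [M N [(M' & N' & H1 & H2 & H3)|H]|M|M N P _ IH1 _ IH2]; intros k; auto.
  - rewrite (Hq _ _ H1), <- (Hq _ _ H3).
    revert k; apply (compat_kfree (fun a b => b = true -> a = true) rule); auto.
    + intros [] [] [] []; simpl; auto.
    + apply rule_kfree.
  - rewrite (Hq _ _ H); auto.
Qed.

(** * Sorts of target terms *)

Inductive sort := SVal | SComp | SStmt | SKont.

Definition sort_var (b : space) : sort := match b with Ord => SVal | Cont => SKont end.
Definition sort_fun (a : kind) : sort :=
  match a with Fun => SVal | Bnd => SKont | Ctl => SComp end.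
Definition sort_res (a : kind) : sort :=
  match a with Fun => SComp | _ => SStmt end.

Fixpoint wf (s : sort) (t : tm) : Prop :=
  match t with
  | V b _ => s = sort_var b
  | L a t => s = sort_fun a /\ wf (sort_res a) t
  | A a t u => s = sort_res a /\ wf (sort_fun a) t /\ wf (sort_var (dom a)) u
  end.

Lemma wf_ren t : forall s xi, wf s (ren xi t) <-> wf s t.
Proof.
  induction t as [b n|a t IH|a t IHt u IHu]; simpl; intros s xi; rewrite ?IH, ?IHt, ?IHu; tauto.
Qed.

Definition wf_sub (r : space -> nat -> tm) : Prop := forall b n, wf (sort_var b) (r b n).

Lemma wf_sub_up b r : wf_sub r -> wf_sub (up b r).
Proof.
  intros H c n; unfold up; destruct b, c, n; try (apply wf_ren, H); reflexivity.
Qed.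

Lemma wf_sub_inst b u : wf (sort_var b) u -> wf_sub (inst b u).
Proof. intros H c n; unfold inst; destruct b, c, n; auto; reflexivity. Qed.

Lemma sub_wf t : forall s r, wf_sub r -> wf s t -> wf s (sub r t).
Proof.
  induction t as [b n|a t IH|a t IHt u IHu]; simpl; intros s r Hr H.
  - subst; apply Hr.
  - split; [|apply IH; [apply wf_sub_up|]]; tauto.
  - destruct H as (? & ? & ?); auto.
Qed.

Lemma tred_wf t t' : tred t t' -> forall s, wf s t -> wf s t'.
Proof.
  induction 1; simpl; intros s H'.
  - destruct H' as (-> & (_ & ?) & ?); apply sub_wf; auto; apply wf_sub_inst; auto.
  - destruct H' as (-> & _ & H' & _); apply wf_ren in H'; auto.
  - destruct H'; auto.
  - destruct H' as (? & ? & ?); auto.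
  - destruct H' as (? & ? & ?); auto.
Qed.

(** * Reading target terms back *)

(* [Eps B] with [r_eps_gc] applied if possible. *)
Definition geps (B : term) : term := if kfree 0 B then Eps B else sren (kinst 0) B.

(* [Eps (Throw j M)], simplified. *)
Definition throw_body (j : nat) (M : term) : term :=
  match j with 0 => M | S _ => Throw j M end.
Definition meps (j : nat) (M : term) : term := geps (throw_body j M).

(* The continuation variable a statement or continuation finally returns to. *)
Fixpoint tail (t : tm) : nat :=
  match t with
  | V _ n => n
  | L _ t => tail t
  | A Ctl _ t => tail t
  | A _ t _ => tail t
  end.

Definition is_var (t : tm) : bool := match t with V _ _ => true | _ => false end.

(** The reading is a separate argument [P], so that [rd] can use the function inside its own
    recursion and [rd_sub] can pass a substituted reading. The answer [None] also keeps the
    placeholder [Var 0], by which [rd] reads continuation variables, from ever becoming a frame. *)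
Definition frame_of (t : tm) (P : term) : option term := if is_var t then None else Some P.

(* A statement [S] stands for [throw_(tail S) (rd S)], and a continuation
   [\x.S] for [throw_(tail S) (rd S where x := [])]. *)
Fixpoint rd (t : tm) : term :=
  match t with
  | V Ord n => Var n
  | V Cont _ => Var 0
  | L Fun t => Lam (rd t)
  | L Bnd t => rd t
  | L Ctl t => meps (tail t) (rd t)
  | A Fun t u => App (rd t) (rd u)
  | A Bnd t u => plug (frame_of t (rd t)) (rd u)
  | A Ctl t u => plug (frame_of u (rd u)) (rd t)
  end.

Definition frame (t : tm) : option term := frame_of t (rd t).

Lemma rd_value t : wf SVal t -> is_value (rd t).
Proof.
  destruct t as [[] n|[] t|[] t u]; simpl; auto; try discriminate; intros []; discriminate.
Qed.

Lemma wf_kont_cases t : wf SKont t ->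
  (exists n, t = V Cont n) \/ exists t0, t = L Bnd t0 /\ wf SStmt t0.
Proof.
  destruct t as [[] n|[] t|[] t u]; simpl; auto; try discriminate; intros H;
    try (destruct H; discriminate); eauto; destruct H; eauto.
Qed.

Lemma geps_spec B : reds (Eps B) (geps B).
Proof.
  unfold geps; destruct (kfree 0 B) eqn:E; [apply rt_refl|].
  (* Since index 0 is not free, lifting undoes the removal of the binder and exhibits [B] in the
     form required by [r_eps_gc]. *)
  replace B with (klift 0 (sren (kinst 0) B)) at 1; [apply rule_reds, r_eps_gc|].
  rewrite klift0; erewrite sren_sren by (intros; reflexivity).
  transitivity (sren (fun _ n => n) B); [|apply sren_id; auto].
  apply sren_ext; auto; intros [|k] Hk; simpl; auto; congruence.
Qed.

(** A block erased around [B] is also erased around [B'], because reduction creates no free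
    continuation variable; in that case the reduction is merely renamed. *)
Lemma geps_reds B B' : reds B B' -> reds (geps B) (geps B').
Proof.
  intros H; unfold geps at 1; destruct (kfree 0 B) eqn:E.
  - apply rt_trans with (Eps B'); [apply reds_eps; auto|apply geps_spec].
  - unfold geps; destruct (kfree 0 B') eqn:E'.
    + apply (reds_kfree _ _ H) in E'; congruence.
    + apply reds_sren; auto.
Qed.

Lemma geps_throw j M : reds (geps (Throw j M)) (meps j M).
Proof.
  destruct j; [|apply rt_refl]; unfold geps at 1; simpl.
  eapply rt_trans; [apply rule_reds, r_eps_throw|apply geps_spec].
Qed.

Lemma kfree_up_cont xi B : kfree 0 (sren (upr Cont xi) B) = kfree 0 B.
Proof. apply kfree_sren; intros [|k]; auto. Qed.

Lemma sren_geps xi B : sren xi (geps B) = geps (sren (upr Cont xi) B).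
Proof.
  unfold geps; rewrite kfree_up_cont; destruct (kfree 0 B) eqn:E; simpl; auto.
  erewrite !sren_sren by (intros; reflexivity).
  apply sren_ext; auto; intros [|k] Hk; simpl; auto; congruence.
Qed.

Lemma sren_meps xi j M :
  sren xi (meps j M) = meps (upr Cont xi Cont j) (sren (upr Cont xi) M).
Proof. unfold meps; rewrite sren_geps; destruct j; auto. Qed.

Lemma geps_shift M : geps (sren (shift Cont) M) = M.
Proof.
  unfold geps; destruct (kfree 0 (sren (shift Cont) M)) eqn:E.
  - apply kfree_sren_inv in E; destruct E as (i & _ & E); discriminate.
  - erewrite sren_sren by (intros; reflexivity); apply sren_id; intros [] n; auto.
Qed.

(** Under the binder all substituted values and frames are shifted past index 0, so a vacuous block
    remains vacuous. *)
Lemma msub_geps s th B :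
  reds (msub s th (geps B)) (geps (msub (up_cont_val s) (up_cont_frame th) B)).
Proof.
  unfold geps at 1; destruct (kfree 0 B) eqn:E; simpl; [apply geps_spec|].
  unfold geps; destruct (kfree 0 (msub _ _ B)) eqn:E'.
  - apply kfree_msub in E'; destruct E' as [([|i] & Hi & H)|(n & H)].
    + congruence.
    + simpl in H; destruct H as [H|(P & H1 & H2)]; [discriminate|].
      destruct (snd (th i)); simpl in H1; [|discriminate]; injection H1 as <-.
      apply kfree_sren_inv in H2; destruct H2 as (j & _ & H2); discriminate.
    + apply kfree_sren_inv in H; destruct H as (j & _ & H); discriminate.
  - erewrite (sren_msub B); [| |intros; reflexivity].
    2:{ intros n; unfold up_cont_val; erewrite sren_sren by (intros; reflexivity).
        apply sren_id; intros [] m; auto. }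
    erewrite msub_sren by (intros; reflexivity).
    erewrite msub_ext; [apply rt_refl|auto|].
    intros [|k] Hk; [congruence|]; simpl.
    destruct (th k) as [j [P|]]; simpl; auto; repeat f_equal.
    erewrite sren_sren by (intros; reflexivity); symmetry; apply sren_id.
    intros [] [|m]; auto.
Qed.

(* Under a continuation, readings live below the binder of the frame. *)
Definition up_sort (s : sort) (xi : space -> nat -> nat) : space -> nat -> nat :=
  match s with SKont => upr Ord xi | _ => xi end.

Lemma is_var_ren xi t : is_var (ren xi t) = is_var t.
Proof. destruct t; auto. Qed.

(** On statements and continuations the path followed by [tail] crosses only [Bnd] binders, which
    bind ordinary variables, so the index found needs no adjustment. *)
Lemma tail_ren t : forall s xi, wf s t -> s = SStmt \/ s = SKont ->
  tail (ren xi t) = xi Cont (tail t).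
Proof.
  induction t as [b n|a t IH|a t IHt u IHu]; simpl; intros s xi H Hs.
  - destruct b; auto; subst; simpl in *; destruct Hs; discriminate.
  - destruct H as [-> H]; destruct a; simpl in *; try (destruct Hs; discriminate).
    rewrite (IH SStmt); auto.
  - destruct H as (-> & H1 & H2); destruct a; simpl in *; try (destruct Hs; discriminate).
    + apply (IHt SKont); auto.
    + apply (IHu SKont); auto.
Qed.

Lemma sren_plug xi f M :
  sren xi (plug f M) = plug (option_map (sren (upr Ord xi)) f) (sren xi M).
Proof. destruct f; auto. Qed.

Lemma rd_ren t : forall s xi, wf s t -> rd (ren xi t) = sren (up_sort s xi) (rd t).
Proof.
  induction t as [b n|a t IH|a t IHt u IHu]; simpl; intros s xi H.
  - destruct b; subst; auto.
  - destruct H as [-> H]; destruct a; simpl in *.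
    + rewrite (IH _ _ H); auto.
    + rewrite (IH _ _ H); auto.
    + rewrite sren_meps, (IH _ _ H), (tail_ren _ SStmt); auto.
  - destruct H as (-> & H1 & H2); destruct a; simpl in *.
    + rewrite (IHt _ _ H1), (IHu _ _ H2); auto.
    + rewrite sren_plug, (IHt _ _ H1), (IHu _ _ H2); unfold frame_of.
      rewrite is_var_ren; destruct (is_var t); auto.
    + rewrite sren_plug, (IHt _ _ H1), (IHu _ _ H2); unfold frame_of.
      rewrite is_var_ren; destruct (is_var u); auto.
Qed.

(** * Reduction of statements *)

(* [(j, M)] stands for [throw_j M]. *)
Inductive spred : relation (nat * term) :=
| sp_red : forall j M M', reds M M' -> spred (j, M) (j, M')
| sp_throw : forall j k M, spred (j, Throw k M) (k, M)
| sp_eps : forall j M, spred (j, Eps M) (j, krename 0 j M).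

Notation spreds := (clos_refl_trans (nat * term) spred).

Lemma spreds_red j M M' : reds M M' -> spreds (j, M) (j, M').
Proof. intros; apply rt_step, sp_red; auto. Qed.

(** A throw or block in the body of a [Where] is moved outwards by [se_throw] or [se_eps], where it
    meets the implicit outer throw. *)
Lemma spreds_where p q N : spreds p q ->
  spreds (fst p, Where (snd p) N) (fst q, Where (snd q) N).
Proof.
  induction 1 as [p q [j M M' H|j k M|j M]|p|p q r _ IH1 _ IH2]; simpl.
  - apply spreds_red, reds_where; auto; apply rt_refl.
  - eapply rt_trans; [apply spreds_red, struct_reds, se_throw|apply rt_step, sp_throw].
  - eapply rt_trans; [apply spreds_red, struct_reds, se_eps|].
    eapply rt_trans; [apply rt_step, sp_eps|]; simpl.
    replace (krename 0 j (klift 0 N)) with N; [apply rt_refl|].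
    rewrite krename0, klift0; erewrite sren_sren by (intros; reflexivity).
    symmetry; apply sren_id; intros [] n; auto.
  - apply rt_refl.
  - eapply rt_trans; eauto.
Qed.

(** If [j] is a successor, the implicit throw is present in [meps], and [sp_throw] and [sp_eps] are
    [r_throw_throw] and [r_throw_eps]. If [j] is 0 it has been erased, and the enclosing block takes
    over with [r_eps_throw] and [r_eps_eps]. *)
Lemma spreds_meps p q : spreds p q ->
  reds (meps (fst p) (snd p)) (meps (fst q) (snd q)).
Proof.
  induction 1 as [p q [j M M' H|j k M|j M]|p|p q r _ IH1 _ IH2]; simpl.
  - apply geps_reds; destruct j; auto; apply reds_throw; auto.
  - destruct j; unfold meps at 1; simpl; [apply geps_throw|].
    eapply rt_trans; [apply geps_reds, rule_reds, r_throw_throw|apply geps_throw].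
  - destruct j; unfold meps; simpl; [|apply geps_reds, rule_reds, r_throw_eps].
    unfold geps at 1; destruct (kfree 0 (Eps M)) eqn:E.
    + eapply rt_trans; [apply rule_reds, r_eps_eps|apply geps_spec].
    (* The outer block is vacuous. Erasing it and merging the inner block into it agree, as the two
       renamings differ only at index 1, which is not free in [M]. *)
    + simpl in *.
      replace (sren (upr Cont (kinst 0)) M) with (krename 0 0 M); [apply geps_spec|].
      rewrite krename0; apply sren_ext; auto.
      intros [|[|k]] Hk; simpl; auto; congruence.
  - apply rt_refl.
  - eapply rt_trans; eauto.
Qed.

Definition rd_frames (r : space -> nat -> tm) (k : nat) : nat * option term :=
  (tail (r Cont k), frame (r Cont k)).

Definition rd_vals (r : space -> nat -> tm) (n : nat) : term := rd (r Ord n).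

Lemma frame_ren xi t : wf SKont t ->
  frame (ren xi t) = option_map (sren (upr Ord xi)) (frame t).
Proof.
  intros H; unfold frame, frame_of; rewrite is_var_ren, (rd_ren _ _ _ H).
  destruct (is_var t); auto.
Qed.

Lemma rd_vals_up_ord r : wf_sub r -> forall n, up_ord_val (rd_vals r) n = rd_vals (up Ord r) n.
Proof.
  intros H [|n]; auto; simpl; unfold rd_vals; simpl.
  rewrite (rd_ren _ SVal); auto; apply (H Ord).
Qed.

Lemma rd_vals_up_cont r : wf_sub r ->
  forall n, up_cont_val (rd_vals r) n = rd_vals (up Cont r) n.
Proof.
  intros H n; unfold up_cont_val, rd_vals; simpl.
  rewrite (rd_ren _ SVal); auto; apply (H Ord).
Qed.

Lemma rd_frames_up_ord r : wf_sub r ->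
  forall k, up_ord_frame (rd_frames r) k = rd_frames (up Ord r) k.
Proof.
  intros H k; unfold up_ord_frame, rd_frames; simpl.
  rewrite (tail_ren _ SKont), frame_ren; auto; apply (H Cont).
Qed.

Lemma rd_frames_up_cont r : wf_sub r ->
  forall k, up_cont_frame (rd_frames r) k = rd_frames (up Cont r) k.
Proof.
  intros H [|k]; auto; unfold up_cont_frame, rd_frames; simpl.
  rewrite (tail_ren _ SKont), frame_ren; auto; [|apply (H Cont)|apply (H Cont)].
  destruct (frame (r Cont k)); auto; simpl.
  rewrite (sren_ext _ (shift Cont) (upr Ord (shift Cont))); auto; intros [|n]; auto.
Qed.

Lemma msub_up_ord r M : wf_sub r ->
  msub (up_ord_val (rd_vals r)) (up_ord_frame (rd_frames r)) M =
  msub (rd_vals (up Ord r)) (rd_frames (up Ord r)) M.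
Proof. intros H; apply msub_ext; auto using rd_vals_up_ord, rd_frames_up_ord. Qed.

Lemma msub_up_cont r M : wf_sub r ->
  msub (up_cont_val (rd_vals r)) (up_cont_frame (rd_frames r)) M =
  msub (rd_vals (up Cont r)) (rd_frames (up Cont r)) M.
Proof. intros H; apply msub_ext; auto using rd_vals_up_cont, rd_frames_up_cont. Qed.

Lemma tail_sub t : forall s r, wf s t -> s = SStmt \/ s = SKont -> wf_sub r ->
  tail (sub r t) = tail (r Cont (tail t)).
Proof.
  induction t as [b n|a t IH|a t IHt u IHu]; simpl; intros s r H Hs Hr.
  - destruct b; auto; subst; simpl in *; destruct Hs; discriminate.
  - destruct H as [-> H]; destruct a; simpl in *; try (destruct Hs; discriminate).
    rewrite (IH SStmt); auto using wf_sub_up.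
    simpl; rewrite (tail_ren _ SKont); auto; apply (Hr Cont).
  - destruct H as (-> & H1 & H2); destruct a; simpl in *; try (destruct Hs; discriminate).
    + apply (IHt SKont); auto.
    + apply (IHu SKont); auto.
Qed.

(* For a statement the frame put around its tail moves, by [se_assoc], to the
   outside of its reading. *)
Lemma rd_sub t : forall s r, wf s t -> wf_sub r ->
  match s with
  | SStmt => reds (plug (frame (r Cont (tail t))) (msub (rd_vals r) (rd_frames r) (rd t)))
               (rd (sub r t))
  | SKont => forall M,
      reds (plug (frame (r Cont (tail t)))
             (plug (frame_of t (msub (rd_vals (up Ord r)) (rd_frames (up Ord r)) (rd t))) M))
           (plug (frame (sub r t)) M)
  | _ => reds (msub (rd_vals r) (rd_frames r) (rd t)) (rd (sub r t))
  end.
Proof.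
  induction t as [b n|a t IH|a t IHt u IHu]; simpl; intros s r H Hr.
  - destruct b; subst; simpl; intros; apply rt_refl.
  - destruct H as [-> H]; specialize (IH _ (up (dom a) r) H (wf_sub_up _ _ Hr));
      destruct a; simpl in *.
    + rewrite msub_up_ord; auto using reds_lam.
    + intros M; eapply rt_trans; [|apply reds_where; [exact IH|apply rt_refl]].
      rewrite frame_ren by apply (Hr Cont).
      destruct (frame (r Cont (tail t))) as [P|]; simpl; [|apply rt_refl].
      rewrite <- lift1; apply struct_reds, se_assoc.
    + eapply rt_trans; [apply msub_geps|]; rewrite msub_up_cont; auto.
      rewrite (tail_sub _ SStmt); auto using wf_sub_up.
      (* For tail 0 the frame is empty and nothing is thrown; for a successor, [msub] puts under the
         explicit throw exactly the frame that the induction hypothesis asks for. *)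
      apply geps_reds; destruct (tail t) as [|k]; simpl in *; auto.
      rewrite (tail_ren _ SKont); auto; [|apply (Hr Cont)].
      simpl; apply reds_throw; auto.
  - destruct H as (-> & H1 & H2); specialize (IHt _ r H1 Hr); specialize (IHu _ r H2 Hr);
      destruct a; simpl in *.
    + apply reds_app; auto.
    + eapply rt_trans; [|apply IHt]; apply reds_plug.
      unfold frame_of; destruct (is_var t); simpl; auto.
      rewrite msub_up_ord; auto; apply reds_where; auto; apply rt_refl.
    + eapply rt_trans; [|apply IHu]; apply reds_plug.
      unfold frame_of; destruct (is_var u); simpl; auto.
      rewrite msub_up_ord; auto; apply reds_where; auto; apply rt_refl.
Qed.

(** * Target reduction is simulated by the reading *)

(** [r_where_eps] inserts the frame of [K] at every throw to the block, and [sp_eps] then redirects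
    these throws to the tail of [K]; together they substitute [K]. In a vacuous block there is
    nothing to substitute for. *)
Lemma geps_frame K B : wf SKont K ->
  spreds (tail K, plug (frame K) (geps B))
    (tail K, plug (frame K) (msub (rd_vals (inst Cont K)) (rd_frames (inst Cont K)) B)).
Proof.
  intros HK; unfold geps; destruct (kfree 0 B) eqn:E.
  - destruct (wf_kont_cases _ HK) as [(j & ->)|(s & -> & Hs)]; simpl.
    + eapply rt_trans; [apply rt_step, sp_eps|].
      rewrite krename0, sren_as_msub.
      erewrite msub_ext; [apply rt_refl|auto|]. intros [|k]; auto.
    + eapply rt_trans; [apply spreds_red, rule_reds, r_where_eps|].
      eapply rt_trans; [apply rt_step, sp_eps|]; simpl.
      rewrite !krename0, csubst0, klift0.
      erewrite sren_sren by (intros; reflexivity).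
      rewrite sren_id by (intros [] n; auto).
      erewrite sren_msub; [|intros; reflexivity|intros; reflexivity].
      erewrite msub_ext; [apply rt_refl|auto|].
      intros [|k] _; auto; unfold rd_frames; simpl.
      erewrite sren_sren by (intros; reflexivity).
      rewrite sren_id; auto. intros [] [|n]; auto.
  - rewrite sren_as_msub; erewrite msub_ext; [apply rt_refl|auto|].
    intros [|k] Hk; [congruence|auto].
Qed.

(** If [s] returns to the bound variable, the frame of [K] stays around its reading, as [rd_sub]
    expects. Otherwise the body is a throw elsewhere, which discards that frame by [r_where_throw]
    and the outer target by [sp_throw]. *)
Lemma rd_beta_ctl s K : wf SStmt s -> wf SKont K ->
  spreds (tail K, plug (frame K) (meps (tail s) (rd s)))
    (tail (sub (inst Cont K) s), rd (sub (inst Cont K) s)).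
Proof.
  intros Hs HK; assert (Hi : wf_sub (inst Cont K)) by (apply wf_sub_inst; auto).
  eapply rt_trans; [apply geps_frame; auto|].
  rewrite (tail_sub _ SStmt); auto.
  pose proof (rd_sub _ SStmt _ Hs Hi) as H; simpl in H.
  destruct (tail s) as [|k]; simpl in *; [apply spreds_red; auto|].
  eapply rt_trans; [|apply spreds_red, H].
  eapply rt_trans; [|apply rt_step, sp_throw].
  apply spreds_red; destruct (frame K); simpl; [apply rule_reds, r_where_throw|apply rt_refl].
Qed.

Lemma rd_beta_ord s t w : wf s t -> s = SComp \/ s = SStmt -> wf SVal w ->
  reds (Where (rd t) (rd w)) (rd (sub (inst Ord w) t)).
Proof.
  intros Ht Hs Hw; assert (Hi : wf_sub (inst Ord w)) by (apply wf_sub_inst; auto).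
  eapply rt_trans; [apply rule_reds, r_where_val, rd_value; auto|].
  rewrite subst0.
  rewrite (msub_ext _ _ (rd_vals (inst Ord w)) _ (rd_frames (inst Ord w)))
    by (auto; intros [|n]; auto).
  pose proof (rd_sub _ _ _ Ht Hi) as H; destruct Hs; subst; auto.
Qed.

(** For a variable [K] this is [r_where_var]. For an abstraction the eta redex is at the same time a
    beta redex, read as a [Where] that binds a variable to a variable. *)
Lemma rd_eta_kont K M : wf SKont K ->
  reds (Where (rd (A Bnd (sh Ord K) (V Ord 0))) M) (plug (frame K) M).
Proof.
  intros HK; destruct (wf_kont_cases _ HK) as [(j & ->)|(s & -> & Hs)]; simpl.
  - apply rule_reds, r_where_var.
  - apply reds_where; [|apply rt_refl].
    rewrite (rd_ren _ _ _ Hs); simpl.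
    eapply rt_trans; [apply rule_reds, r_where_val; exact I|].
    rewrite subst0; erewrite msub_sren by (intros; reflexivity).
    rewrite <- (sren_id (rd s) (fun _ n => n)) at 2 by auto.
    rewrite sren_as_msub; erewrite msub_ext; [apply rt_refl| |auto]. intros [|n]; auto.
Qed.

(** A step may change where a statement returns, so statements are compared together with their
    tails. The reading of a continuation is only a frame, so continuations are compared by their
    action on an arbitrary [M]. *)
Lemma rd_tred t t' : tred t t' -> forall s, wf s t ->
  match s with
  | SStmt => spreds (tail t, rd t) (tail t', rd t')
  | SKont => forall M, spreds (tail t, plug (frame t) M) (tail t', plug (frame t') M)
  | _ => reds (rd t) (rd t')
  end.
Proof.
  induction 1 as [a t u|a t|a t t' H IH|a t t' u H IH|a t u u' H IH]; simpl; intros s Hw.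
  - destruct Hw as (-> & (_ & Ht) & Hu); destruct a; simpl in *.
    + eapply rt_trans; [apply rule_reds, r_beta, rd_value; auto|].
      apply (rd_beta_ord SComp); auto.
    + rewrite (tail_sub _ SStmt); auto using wf_sub_inst.
      apply spreds_red, (rd_beta_ord SStmt); auto.
    + apply rd_beta_ctl; auto.
  - destruct Hw as (-> & _ & Ht & _); apply wf_ren in Ht; destruct a; simpl in *.
    + rewrite (rd_ren _ _ _ Ht), <- lift0; apply rule_reds, r_eta, rd_value; auto.
    + intros M; rewrite (tail_ren _ SKont); auto.
      apply spreds_red, rd_eta_kont; auto.
    (* Eta on computations is invisible: the reading has already erased the throw and the vacuous
       block. *)
    + rewrite (rd_ren _ _ _ Ht); unfold meps; simpl; rewrite geps_shift; apply rt_refl.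
  - destruct Hw as (-> & Ht); specialize (IH _ Ht); destruct a; simpl in *.
    + apply reds_lam; auto.
    + intros M; apply (spreds_where _ _ M) in IH; auto.
    + apply spreds_meps in IH; auto.
  - destruct Hw as (-> & Ht & Hu); specialize (IH _ Ht); destruct a; simpl in *.
    + apply reds_app; auto; apply rt_refl.
    + apply IH.
    + apply spreds_red, reds_plug; auto.
  - destruct Hw as (-> & Ht & Hu); specialize (IH _ Hu); destruct a; simpl in *.
    + apply reds_app; auto; apply rt_refl.
    + apply spreds_red, reds_plug; auto.
    + apply IH.
Qed.

Lemma rd_treds t t' : treds t t' -> wf SComp t -> reds (rd t) (rd t').
Proof.
  intros H; apply clos_rt_rt1n in H; induction H as [t|t u t' H _ IH]; intros Hw.
  - apply rt_refl.
  - eapply rt_trans; [apply (rd_tred _ _ H _ Hw)|apply IH, (tred_wf _ _ H _ Hw)].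
Qed.

(** * The CPS translation *)

(** [\k. k v], the unit of the continuation monad; [bind] is its sequencing [\k. c (\x. d k)], with
    [x] the ordinary index 0 of [d]. *)
Definition ret (v : tm) : tm := L Ctl (A Bnd (V Cont 0) (sh Cont v)).

Definition bind (c d : tm) : tm :=
  L Ctl (A Ctl (sh Cont c) (L Bnd (A Ctl (sh Cont d) (V Cont 0)))).

(* [Some v] marks an operand that is a value; only other operands are named,
   so that an application of values is not expanded. *)
Definition cps_app (o1 : option tm) (c1 : tm) (o2 : option tm) (c2 : tm) : tm :=
  match o1, o2 with
  | Some v, Some w => A Fun v w
  | Some v, None => bind c2 (A Fun (sh Ord v) (V Ord 0))
  | None, Some w => bind c1 (A Fun (V Ord 0) (sh Ord w))
  | None, None => bind c1 (bind (sh Ord c2) (A Fun (V Ord 1) (V Ord 0)))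
  end.

(** A block [\k. M k] hands its own continuation to its body. A throw [\k'. M k] ignores the current
    continuation [k'], whose binder shifts [k] to [S k]. *)
Fixpoint cps (M : term) : tm :=
  let value M := match M with
    | Var n => Some (V Ord n)
    | Lam M => Some (L Fun (cps M))
    | _ => None
    end in
  match M with
  | Var n => ret (V Ord n)
  | Lam M => ret (L Fun (cps M))
  | App M N => cps_app (value M) (cps M) (value N) (cps N)
  | Where P N => bind (cps N) (cps P)
  | Eps M => L Ctl (A Ctl (cps M) (V Cont 0))
  | Throw k M => L Ctl (A Ctl (sh Cont (cps M)) (V Cont (S k)))
  end.

(** A copy of the local function of [cps], which has to be local there because it calls [cps]
    recursively. *)
Definition value (M : term) : option tm :=
  match M with
  | Var n => Some (V Ord n)
  | Lam M => Some (L Fun (cps M))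
  | _ => None
  end.

Lemma cps_App M N : cps (App M N) = cps_app (value M) (cps M) (value N) (cps N).
Proof. reflexivity. Qed.

Lemma cps_value M v : value M = Some v -> cps M = ret v.
Proof. destruct M; simpl; intros H; try discriminate; injection H as <-; auto. Qed.

Lemma is_value_value M : is_value M -> exists v, value M = Some v.
Proof. destruct M; simpl; try tauto; eauto. Qed.

Lemma not_is_value_value M : ~ is_value M -> value M = None.
Proof. destruct M; simpl; tauto. Qed.

Lemma value_is_value M v : value M = Some v -> is_value M.
Proof. destruct M; simpl; intros; auto; discriminate. Qed.

Lemma value_is_value_none M : value M = None -> ~ is_value M.
Proof. destruct M; simpl; intros; auto; discriminate. Qed.

Lemma wf_ret v : wf SVal v -> wf SComp (ret v).
Proof. unfold ret; simpl; rewrite wf_ren; auto. Qed.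

Lemma wf_bind c d : wf SComp c -> wf SComp d -> wf SComp (bind c d).
Proof. unfold bind; simpl; rewrite !wf_ren; auto 10. Qed.

Lemma cps_wf M : wf SComp (cps M) /\ forall v, value M = Some v -> wf SVal v.
Proof.
  induction M as [n|M [IH _]|M [IH1 IH1'] N [IH2 IH2']|P [IHP _] N [IHN _]|M [IH _]|k M [IH _]];
    (split; [|simpl; intros v Hv; try discriminate; injection Hv as <-; simpl; auto]).
  - apply wf_ret; simpl; auto.
  - apply wf_ret; simpl; auto.
  - rewrite cps_App; destruct (value M), (value N); simpl; auto;
      repeat apply wf_bind; simpl; rewrite ?wf_ren; auto 20.
  - apply wf_bind; auto.
  - simpl; auto.
  - simpl; rewrite wf_ren; auto.
Qed.

Lemma ren_ret xi v : ren xi (ret v) = ret (ren xi v).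
Proof. unfold ret; simpl; rewrite ren_up; auto. Qed.

Lemma ren_bind xi c d : ren xi (bind c d) = bind (ren xi c) (ren (upr Ord xi) d).
Proof.
  unfold bind; simpl; rewrite ren_up; do 4 f_equal.
  erewrite !ren_ren by (intros; reflexivity).
  apply ren_ext; intros [] [|n]; auto.
Qed.

Lemma sub_ret r v : sub r (ret v) = ret (sub r v).
Proof. unfold ret; simpl; rewrite sub_up; auto. Qed.

Lemma sub_bind r c d : sub r (bind c d) = bind (sub r c) (sub (up Ord r) d).
Proof.
  unfold bind; simpl; rewrite sub_up; do 4 f_equal.
  erewrite sub_ren, ren_sub by (intros; reflexivity).
  apply sub_ext; intros [] [|n]; simpl; auto; erewrite !ren_ren by (intros; reflexivity);
    apply ren_ext; intros [] [|m]; auto.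
Qed.

Lemma ren_cps_app xi o1 c1 o2 c2 :
  ren xi (cps_app o1 c1 o2 c2) =
  cps_app (option_map (ren xi) o1) (ren xi c1) (option_map (ren xi) o2) (ren xi c2).
Proof.
  destruct o1, o2; cbn [cps_app option_map]; rewrite ?ren_bind; cbn [ren];
    rewrite ?ren_up; auto.
Qed.

Lemma cps_sren M : forall xi,
  cps (sren xi M) = ren xi (cps M) /\ value (sren xi M) = option_map (ren xi) (value M).
Proof.
  induction M as [n|M IH|M IHM N IHN|P IHP N IHN|M IH|k M IH]; intros xi.
  - auto.
  - cbn [sren cps value option_map ren]; destruct (IH (upr Ord xi)) as [-> _].
    split; auto; rewrite ren_ret; auto.
  - split; auto; cbn [sren]; rewrite !cps_App, ren_cps_app.
    destruct (IHM xi) as [-> ->], (IHN xi) as [-> ->]; auto.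
  - split; auto; cbn [sren cps]; rewrite ren_bind.
    destruct (IHP (upr Ord xi)) as [-> _], (IHN xi) as [-> _]; auto.
  - split; auto; simpl; destruct (IH (upr Cont xi)) as [-> _]; auto.
  - split; auto; simpl; destruct (IH xi) as [-> _]; rewrite ren_up; auto.
Qed.

(** The statement inside returns to the block's own variable, so its throw is erased; [c] and [d]
    are shifted past that variable, so the block is erased too. *)
Lemma rd_bind c d : wf SComp c -> wf SComp d -> rd (bind c d) = Where (rd d) (rd c).
Proof.
  intros Hc Hd; unfold bind; simpl.
  rewrite (rd_ren _ _ _ Hc), (rd_ren _ _ _ Hd); unfold meps; simpl.
  etransitivity; [|apply geps_shift]; simpl; do 2 f_equal.
  apply sren_ext; auto; intros [|n]; auto.
Qed.

Lemma rd_ret v : wf SVal v -> rd (ret v) = rd v.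
Proof.
  intros Hv; unfold ret; simpl; rewrite (rd_ren _ _ _ Hv); apply geps_shift.
Qed.

(** Only the naming rules [r_appl] and [r_appr] and the erasure of blocks are used. The second
    conjunct serves the value operands, which [cps_app] takes without [ret]. *)
Lemma reds_rd_cps M : reds M (rd (cps M)) /\ forall v, value M = Some v -> reds M (rd v).
Proof.
  induction M as [n|M [IH _]|M [IH1 IH1'] N [IH2 IH2']|P [IHP _] N [IHN _]|M [IH _]|k M [IH _]];
    (split; [|simpl; intros v Hv; try discriminate; injection Hv as <-; simpl]).
  - apply rt_refl.
  - apply rt_refl.
  - cbn [cps]; rewrite rd_ret by (simpl; split; auto; apply cps_wf); apply reds_lam; auto.
  - apply reds_lam; auto.
  - rewrite cps_App.
    destruct (cps_wf M) as [HM HM'], (cps_wf N) as [HN HN'].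
    destruct (value M) as [v|] eqn:EM, (value N) as [w|] eqn:EN; cbn [cps_app].
    + apply reds_app; auto.
    + specialize (HM' _ eq_refl).
      rewrite rd_bind by (simpl; rewrite ?wf_ren; auto); simpl.
      rewrite (rd_ren _ _ _ HM'); simpl.
      eapply rt_trans; [apply rule_reds, r_appr; [eapply value_is_value|
        apply value_is_value_none]; eauto|].
      rewrite lift0; apply reds_where; auto; apply reds_app; [apply reds_sren; auto|apply rt_refl].
    + specialize (HN' _ eq_refl).
      rewrite rd_bind by (simpl; rewrite ?wf_ren; auto); simpl.
      rewrite (rd_ren _ _ _ HN'); simpl.
      eapply rt_trans; [apply rule_reds, r_appl, value_is_value_none; auto|].
      rewrite lift0; apply reds_where; auto; apply reds_app; [apply rt_refl|apply reds_sren; auto].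
    + rewrite !rd_bind; try (repeat apply wf_bind; simpl; rewrite ?wf_ren; auto 20; fail); simpl.
      rewrite (rd_ren _ _ _ HN); simpl.
      eapply rt_trans; [apply rule_reds, r_appl, value_is_value_none; auto|].
      rewrite lift0; apply reds_where; auto.
      eapply rt_trans; [apply rule_reds, r_appr; [exact I|]|].
      * rewrite is_value_sren; apply value_is_value_none; auto.
      * simpl; apply reds_where; [apply rt_refl|apply reds_sren; auto].
  - cbn [cps]; rewrite rd_bind by apply cps_wf; apply reds_where; auto.
  - simpl; eapply rt_trans; [apply reds_eps; eauto|apply geps_spec].
  - simpl; rewrite (rd_ren _ SComp) by apply cps_wf; unfold meps; simpl.
    change (Throw (S k) (sren (shift Cont) (rd (cps M))))
      with (sren (shift Cont) (Throw k (rd (cps M)))).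
    rewrite geps_shift; apply reds_throw; auto.
Qed.

(** * Soundness of the CPS translation *)

Global Instance tconv_equivalence : Equivalence tconv.
Proof. split; red; intros; [apply rst_refl|apply rst_sym|eapply rst_trans]; eauto. Qed.

Lemma tconv_map (f : tm -> tm) :
  (forall t t', tred t t' -> tred (f t) (f t')) ->
  forall t t', tconv t t' -> tconv (f t) (f t').
Proof.
  intros H; induction 1; [apply rst_step|apply rst_refl|apply rst_sym|eapply rst_trans]; eauto.
Qed.

Global Instance tconv_lam a : Proper (tconv ==> tconv) (L a).
Proof. intros t t'; apply tconv_map; apply t_lam. Qed.

Global Instance tconv_app a : Proper (tconv ==> tconv ==> tconv) (A a).
Proof.
  intros t t' H1 u u' H2; transitivity (A a t' u).
  - apply (tconv_map (fun t => A a t u)); auto; intros; apply t_appl; auto.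
  - apply (tconv_map (A a t')); auto; intros; apply t_appr; auto.
Qed.

Lemma tred_sub t t' : tred t t' -> forall r, tred (sub r t) (sub r t').
Proof.
  induction 1; intros r; simpl.
  - rewrite sub_inst; apply t_beta.
  - rewrite sub_up; replace (up (dom a) r (dom a) 0) with (V (dom a) 0) by (destruct a; auto).
    apply t_eta.
  - apply t_lam; auto.
  - apply t_appl; auto.
  - apply t_appr; auto.
Qed.

Global Instance tconv_sub r : Proper (tconv ==> tconv) (sub r).
Proof. intros t t'; apply tconv_map; intros; apply tred_sub; auto. Qed.

Global Instance tconv_ren xi : Proper (tconv ==> tconv) (ren xi).
Proof. intros t t' H; rewrite !ren_as_sub, H; reflexivity. Qed.

Global Instance tconv_bind : Proper (tconv ==> tconv ==> tconv) bind.
Proof. intros c c' H1 d d' H2; unfold bind; rewrite H1, H2; reflexivity. Qed.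

Lemma beta a t u : tconv (A a (L a t) u) (sub (inst (dom a) u) t).
Proof. apply rst_step, t_beta. Qed.

Lemma eta a t : tconv (L a (A a (sh (dom a) t) (V (dom a) 0))) t.
Proof. apply rst_step, t_eta. Qed.

Lemma sub_inst_cont_up d K :
  sub (up Ord (inst Cont K)) (sh Cont d) = d.
Proof.
  erewrite sub_ren by (intros; reflexivity); apply sub_id; intros [] [|n]; auto.
Qed.

Lemma run_bind c d K :
  tconv (A Ctl (bind c d) K) (A Ctl c (L Bnd (A Ctl d (sh Ord K)))).
Proof.
  unfold bind; rewrite beta; simpl.
  rewrite sub_inst_cont_up, (sub_inst_sh Cont K c); reflexivity.
Qed.

Lemma run_ret v K : tconv (A Ctl (ret v) K) (A Bnd K v).
Proof. unfold ret; rewrite beta; simpl; rewrite (sub_inst_sh Cont); reflexivity. Qed.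

(** Extensionality from eta: computations are compared by running them on a fresh continuation. The
    monad laws below are proved this way. *)
Lemma ctl_ext c d :
  tconv (A Ctl (sh Cont c) (V Cont 0)) (A Ctl (sh Cont d) (V Cont 0)) -> tconv c d.
Proof.
  intros H; rewrite <- (eta Ctl c), <- (eta Ctl d); simpl; rewrite H; reflexivity.
Qed.

Lemma bind_ret v d : tconv (bind (ret v) d) (sub (inst Ord v) d).
Proof.
  apply ctl_ext; rewrite ren_bind, run_bind, ren_ret, run_ret, beta; simpl.
  rewrite (ren_inst Ord); reflexivity.
Qed.

Lemma bind_ret_r c : tconv (bind c (ret (V Ord 0))) c.
Proof.
  apply ctl_ext; rewrite ren_bind, run_bind, ren_ret, run_ret; simpl.
  rewrite (eta Bnd (V Cont 0)); reflexivity.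
Qed.

Lemma bind_assoc c d e :
  tconv (bind (bind c d) e) (bind c (bind d (ren (upr Ord (shift Ord)) e))).
Proof.
  apply ctl_ext; rewrite !ren_bind, !run_bind; simpl.
  erewrite !ren_ren by (intros; reflexivity).
  erewrite (ren_ext e); [reflexivity|]. intros [] [|n]; auto.
Qed.

(** A reduction can turn an operand into a value and so change the case chosen by [cps_app]. Up to
    conversion all four cases agree with the one that names both operands, which makes compatibility
    immediate. *)
Lemma cps_App_conv M N :
  tconv (cps (App M N)) (bind (cps M) (bind (sh Ord (cps N)) (A Fun (V Ord 1) (V Ord 0)))).
Proof.
  rewrite cps_App; destruct (value M) as [v|] eqn:EM, (value N) as [w|] eqn:EN;
    cbn [cps_app]; rewrite ?(cps_value _ _ EM), ?(cps_value _ _ EN).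
  - rewrite bind_ret, sub_bind, (sub_inst_sh Ord), bind_ret; simpl.
    rewrite (sub_inst_sh Ord); reflexivity.
  - rewrite bind_ret, sub_bind, (sub_inst_sh Ord); simpl; reflexivity.
  - rewrite ren_ret, bind_ret; simpl; reflexivity.
  - reflexivity.
Qed.

Lemma cps_Where P N : cps (Where P N) = bind (cps N) (cps P).
Proof. reflexivity. Qed.

Lemma cps_lift0 M : cps (lift 0 M) = sh Ord (cps M).
Proof. rewrite lift0; apply cps_sren. Qed.

Lemma cps_klift0 M : cps (klift 0 M) = sh Cont (cps M).
Proof. rewrite klift0; apply cps_sren. Qed.

Lemma cps_krename0 l M : cps (krename 0 l M) = sub (inst Cont (V Cont l)) (cps M).
Proof.
  rewrite krename0; destruct (cps_sren M (kinst l)) as [-> _].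
  rewrite ren_as_sub; apply sub_ext; intros [] [|n]; auto.
Qed.

(** The continuation [\x. P j], or [j] itself, to which a throw rewritten by [msub] passes its
    argument. *)
Definition kont (p : nat * option term) : tm :=
  match snd p with
  | None => V Cont (fst p)
  | Some P => L Bnd (A Ctl (cps P) (V Cont (fst p)))
  end.

Lemma kont_up_ord th k : kont (up_ord_frame th k) = sh Ord (kont (th k)).
Proof.
  unfold kont, up_ord_frame; simpl; destruct (snd (th k)) as [P|]; simpl; auto.
  destruct (cps_sren P (upr Ord (shift Ord))) as [-> _]; auto.
Qed.

Lemma kont_up_cont th k : kont (up_cont_frame th (S k)) = sh Cont (kont (th k)).
Proof.
  unfold kont, up_cont_frame; simpl; destruct (snd (th k)) as [P|]; simpl; auto.
  destruct (cps_sren P (shift Cont)) as [-> _].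
  do 2 f_equal; apply ren_ext; intros [] [|n]; auto.
Qed.

(** An inserted [Where] is translated to a [bind]; running it on [j] contracts it to an application
    to [\x. P j], hence conversion in the conclusion. *)
Lemma cps_msub M : forall s th r, (forall n, value (s n) = Some (r Ord n)) ->
  (forall k, r Cont k = kont (th k)) -> tconv (cps (msub s th M)) (sub r (cps M)).
Proof.
  assert (Hord : forall s th r, (forall n, value (s n) = Some (r Ord n)) ->
    (forall k, r Cont k = kont (th k)) ->
    (forall n, value (up_ord_val s n) = Some (up Ord r Ord n)) /\
    (forall k, up Ord r Cont k = kont (up_ord_frame th k))).
  { intros s th r Ho Hc; split.
    - intros [|n]; auto; simpl.
      destruct (cps_sren (s n) (shift Ord)) as [_ ->]; rewrite Ho; auto.
    - intros k; rewrite kont_up_ord, <- Hc; auto. }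
  induction M as [n|M IH|M IHM N IHN|P IHP N IHN|M IH|k M IH]; intros s th r Ho Hc.
  - cbn [msub cps]; rewrite sub_ret, (cps_value _ _ (Ho n)); reflexivity.
  - cbn [msub cps]; rewrite sub_ret; unfold ret.
    destruct (Hord _ _ _ Ho Hc) as [Ho' Hc'].
    cbn [sub dom]; rewrite (IH _ _ _ Ho' Hc'); reflexivity.
  - cbn [msub]; rewrite !cps_App_conv, !sub_bind, sub_up; simpl.
    rewrite (IHM _ _ _ Ho Hc), (IHN _ _ _ Ho Hc); reflexivity.
  - cbn [msub cps]; rewrite sub_bind.
    destruct (Hord _ _ _ Ho Hc) as [Ho' Hc'].
    rewrite (IHP _ _ _ Ho' Hc'), (IHN _ _ _ Ho Hc); reflexivity.
  - simpl; rewrite (IH _ _ (up Cont r)); [reflexivity| |].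
    + intros n; unfold up_cont_val; simpl.
      destruct (cps_sren (s n) (shift Cont)) as [_ ->]; rewrite Ho; auto.
    + intros [|k]; auto; rewrite kont_up_cont, <- Hc; auto.
  - cbn [msub cps sub dom]; rewrite sub_up.
    change (up Cont r Cont (S k)) with (sh Cont (r Cont k)); rewrite Hc.
    unfold kont; destruct (th k) as [j [P|]]; cbn [fst snd plug cps].
    + rewrite ren_bind, run_bind, (IH _ _ _ Ho Hc); simpl; reflexivity.
    + rewrite (IH _ _ _ Ho Hc); reflexivity.
Qed.

Lemma cps_struct_eq M N : struct_eq M N -> tconv (cps M) (cps N).
Proof.
  intros [P M' N'|M' N'|k M' N']; cbn [cps].
  - rewrite bind_assoc, lift1; destruct (cps_sren P (upr Ord (shift Ord))) as [-> _].
    reflexivity.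
  - rewrite cps_klift0, run_bind; unfold bind; cbn [ren dom].
    rewrite (beta Ctl); cbn [sub dom]; rewrite ren_up_inst; reflexivity.
  - rewrite ren_bind, run_bind; unfold bind; cbn [ren dom].
    rewrite (beta Ctl); cbn [sub dom]; rewrite ren_up, (sub_inst_sh Cont).
    rewrite (ren_ext _ (upr Ord (shift Cont)) (shift Cont)) by (intros [] [|n]; auto).
    reflexivity.
Qed.

Lemma cps_rule M N : rule M N -> tconv (cps M) (cps N).
Proof.
  intros [N' M' H|W N' H1 H2|M' W H|M' W H|W H|M'|M'|M'|M' k N'|l k N'|M' N'|l M'|M'].
  - rewrite cps_Where, !cps_App_conv, cps_lift0; cbn [cps].
    rewrite bind_ret, sub_bind, (sub_inst_sh Ord); simpl; reflexivity.
  - destruct (is_value_value _ H1) as [v Hv].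
    rewrite cps_App, Hv, (not_is_value_value _ H2), cps_Where, cps_App, lift0.
    destruct (cps_sren W (shift Ord)) as [_ ->]; rewrite Hv.
    reflexivity.
  - destruct (is_value_value _ H) as [v Hv].
    rewrite cps_Where, cps_App, Hv, (cps_value _ _ Hv), bind_ret; apply beta.
  - destruct (is_value_value _ H) as [v Hv].
    rewrite cps_Where, (cps_value _ _ Hv), bind_ret, subst0, (cps_msub _ _ _ (inst Ord v)).
    + reflexivity.
    + intros [|n]; auto.
    + reflexivity.
  - destruct (is_value_value _ H) as [v Hv].
    rewrite (cps_value _ _ Hv).
    change (tconv (ret (L Fun (cps (App (lift 0 W) (Var 0))))) (ret v)).
    rewrite cps_App, lift0; destruct (cps_sren W (shift Ord)) as [_ ->]; rewrite Hv.
    cbn [option_map value cps_app]; unfold ret; rewrite (eta Fun v); reflexivity.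
  - cbn [cps]; apply bind_ret_r.
  - cbn [cps]; rewrite cps_klift0; apply (eta Ctl).
  - cbn [cps]; rewrite beta; simpl; rewrite (sub_inst_sh Cont); reflexivity.
  - cbn [cps]; unfold bind; cbn [ren dom]; rewrite beta; cbn [sub dom].
    rewrite ren_up, (sub_inst_sh Cont); reflexivity.
  - cbn [cps]; cbn [ren dom]; rewrite beta; cbn [sub dom].
    rewrite ren_up, (sub_inst_sh Cont); reflexivity.
  - cbn [cps]; rewrite cps_klift0, run_bind, csubst0.
    set (K := L Bnd (A Ctl (sh Cont (cps M')) (V Cont 0))).
    (* The block survives the rule: its index 0 becomes [K], which itself mentions the surviving
       index 0, while shift and instantiation cancel on all other indices. *)
    rewrite (cps_msub _ _ _ (fun b n => inst Cont K b (upr Cont (shift Cont) b n))).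
    + unfold bind; cbn [ren dom]; rewrite beta; cbn [sub dom].
      erewrite sub_ren by (intros; reflexivity); reflexivity.
    + reflexivity.
    + intros [|k]; auto; unfold kont; simpl; rewrite cps_klift0; auto.
  - cbn [cps]; rewrite cps_krename0; cbn [ren dom]; rewrite beta; cbn [sub dom].
    rewrite (ren_inst Cont); reflexivity.
  - cbn [cps]; rewrite cps_krename0, beta; simpl; reflexivity.
Qed.

Lemma compat_cps (R : relation term) :
  (forall M N, R M N -> tconv (cps M) (cps N)) ->
  forall M N, compat R M N -> tconv (cps M) (cps N).
Proof.
  intros H; induction 1; auto; rewrite ?cps_App_conv; cbn [cps]; unfold ret;
    rewrite ?IHcompat; reflexivity.
Qed.

Lemma conv_cps : forall M N, conv M N -> tconv (cps M) (cps N).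
Proof.
  assert (Hq : forall M N, sequiv M N -> tconv (cps M) (cps N)).
  { induction 1 as [M N H|M|M N _ IH|M N P _ IH1 _ IH2].
    - apply (compat_cps _ cps_struct_eq); auto.
    - reflexivity.
    - symmetry; auto.
    - etransitivity; eauto. }
  induction 1 as [M N [(M' & N' & H1 & H2 & H3)|H]|M|M N _ IH|M N P _ IH1 _ IH2].
  - rewrite (Hq _ _ H1), <- (Hq _ _ H3); apply (compat_cps _ cps_rule); auto.
  - auto.
  - reflexivity.
  - symmetry; auto.
  - etransitivity; eauto.
Qed.

Theorem theorem4p6 : forall M1 M2 : term,
  conv M1 M2 -> exists N : term, reds M1 N /\ reds M2 N.
Proof.
  intros M1 M2 H; destruct (tconv_church_rosser _ _ (conv_cps _ _ H)) as (t & H1 & H2).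
  exists (rd t); split.
  - apply rt_trans with (rd (cps M1)); [apply (proj1 (reds_rd_cps _))|apply rd_treds; auto; apply cps_wf].
  - apply rt_trans with (rd (cps M2)); [apply (proj1 (reds_rd_cps _))|apply rd_treds; auto; apply cps_wf].
Qed.
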